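(* Let $n\ge1$. Identify $\mathbb R^{2n}$ with $\mathbb C^n$ via $z_j=x_j+iy_j$, and equip $S^{2n-1}\subset\mathbb C^n$ and $S^n\subset\mathbb R^{n+1}$ with their uniform probability measures. Then the complex random variable $\sum_{j=1}^n z_j^2$ on $S^{2n-1}$ has the same distribution as the complex random variable $x_1+ix_2$ on $S^n$, where $x_1,x_2$ are the first two coordinates of $\mathbb R^{n+1}$. *)

(* Defs.v *)
From HB Require Import structures.
From mathcomp Require Import all_boot all_order all_algebra.
From mathcomp Require Import complex.
From mathcomp Require Import all_classical all_reals all_analysis.
From mathcomp Require Import measurable_realfun.
From mathcomp Require Import ring lra.

Set Implicit Arguments.
Unset Strict Implicit.
Unset Printing Implicit Defensive.

Import Order.TTheory GRing.Theory Num.Theory.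
Import numFieldNormedType.Exports.

Local Open Scope classical_set_scope.
Local Open Scope complex_scope.
Local Open Scope ring_scope.

Section lebesgue_tuple.
Context {R : realType}.

Fixpoint lebesgue_tuple (n : nat) : set (n.-tuple R) -> \bar R :=
  match n with
  | 0 => \d_([tuple] : 0.-tuple R)
  | n'.+1 => pushforward (lebesgue_measure \x @lebesgue_tuple n')%E
               (fun p : measurableTypeR R * n'.-tuple R => [tuple of p.1 :: p.2])
  end.

Definition tcons n (p : measurableTypeR R * n.-tuple R) : n.+1.-tuple R := [tuple of p.1 :: p.2].

Lemma measurable_tcons n : measurable_fun setT (@tcons n).
Proof. exact: measurable_cons. Qed.

Definition tuncons n (t : n.+1.-tuple R) : measurableTypeR R * n.-tuple R :=
  (thead t, [tuple of behead t]).

Lemma measurable_tuncons n : measurable_fun setT (@tuncons n).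
Proof.
apply/measurable_fun_pair; last exact: measurable_behead.
exact: measurable_tnth.
Qed.

Lemma tconsK n : cancel (@tcons n) (@tuncons n).
Proof. by case=> a t; congr pair; apply/val_inj. Qed.

Lemma lebesgue_tuple_sigma_finite n :
  exists mu : {sigma_finite_measure set (n.-tuple R) -> \bar R},
    @lebesgue_tuple n = mu.
Proof.
elim: n => [|n [mu muE]]; first by exists (\d_([tuple] : 0.-tuple R)).
pose prd : {measure set (measurableTypeR R * n.-tuple R)%type -> \bar R} :=
  (lebesgue_measure \x mu)%E.
pose nu : {measure set (n.+1.-tuple R) -> \bar R} :=
  measure_function_pushforward__canonical__measure_function_Measure
    prd (@measurable_tcons n).
have nuE : @lebesgue_tuple n.+1 = nu by rewrite /= muE.
have sf : sigma_finite setT nu.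
  have /sigma_finiteP[F [FT Fnd Foo]] := sigma_finiteT (@lebesgue_measure R).
  have /sigma_finiteP[G [GT Gnd Goo]] := sigma_finiteT mu.
  exists (fun k => @tuncons n @^-1` (F k `*` G k)).
    apply/seteqP; split => // t _.
    have [k1 _ Fk] : (\bigcup_k F k) (tuncons t).1 by rewrite -FT.
    have [k2 _ Gk] : (\bigcup_k G k) (tuncons t).2 by rewrite -GT.
    exists (maxn k1 k2) => //; split.
      by move: Fk; exact/subsetPset/Fnd/leq_maxl.
    by move: Gk; exact/subsetPset/Gnd/leq_maxr.
  move=> k; have [mF Fk] := Foo k; have [mG Gk] := Goo k; split.
    rewrite -[X in measurable X]setTI; apply: measurable_tuncons => //.
    exact: measurableX.
  rewrite /nu/= /pushforward -comp_preimage.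
  rewrite (_ : _ \o _ = id); last by apply/funext => p; exact: tconsK.
  by rewrite preimage_id product_measure1E// lte_mul_pinfty// ge0_fin_numE.
pose nu' : {sigma_finite_measure set (n.+1.-tuple R) -> \bar R} :=
  HB.pack (Measure.sort nu) (Measure_isSigmaFinite.Build _ _ _ (Measure.sort nu) sf).
by exists nu'.
Qed.

Lemma lebesgue_tuple0 n : @lebesgue_tuple n set0 = 0%E.
Proof. by have [mu ->] := lebesgue_tuple_sigma_finite n; rewrite measure0. Qed.

Lemma lebesgue_tuple_ge0 n A : (0 <= @lebesgue_tuple n A)%E.
Proof. by have [mu ->] := lebesgue_tuple_sigma_finite n. Qed.

Lemma lebesgue_tuple_sigma_additive n : semi_sigma_additive (@lebesgue_tuple n).
Proof.
have [mu ->] := lebesgue_tuple_sigma_finite n.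
exact: measure_semi_sigma_additive.
Qed.

HB.instance Definition _ n := isMeasure.Build _ _ _ (@lebesgue_tuple n)
  (lebesgue_tuple0 n) (@lebesgue_tuple_ge0 n) (@lebesgue_tuple_sigma_additive n).

Lemma sigma_finite_lebesgue_tuple n : sigma_finite setT (@lebesgue_tuple n).
Proof.
by have [mu ->] := lebesgue_tuple_sigma_finite n; exact: sigma_finiteT.
Qed.

HB.instance Definition _ n := Measure_isSigmaFinite.Build _ _ _
  (@lebesgue_tuple n) (sigma_finite_lebesgue_tuple n).

Lemma measurable_cube n (I : set R) : measurable I ->
  measurable [set x : n.-tuple R | forall i, I (tnth x i)].
Proof.
move=> mI.
rewrite (_ : [set _ | _] = \bigcap_(i in [set: 'I_n]) ((@tnth n R)^~ i @^-1` I)).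
  apply: fin_bigcap_measurable => // i _.
  by rewrite -[X in measurable X]setTI; exact: measurable_tnth.
by apply/seteqP; split => x /= h i; [move=> _|]; exact: h.
Qed.

Lemma lebesgue_tuple_cube n (I : set R) (c : R) : measurable I ->
  lebesgue_measure I = c%:E ->
  lebesgue_tuple [set x : n.-tuple R | forall i, I (tnth x i)] = (c ^+ n)%:E.
Proof.
move=> mI Ic; elim: n => [|n IH].
  by rewrite /= diracE mem_set//= => -[].
rewrite exprS EFinM -IH -Ic /= /pushforward.
rewrite -(@product_measure1E _ _ _ _ _ lebesgue_measure (@lebesgue_tuple n))//.
- congr (product_measure1 _ _ _); apply/seteqP; split => -[a t] /=.
    move=> h; split=> [|i]; first exact: (h ord0).
    by have := h (lift ord0 i); rewrite tnthS.
  by move=> [ha ht] i; case: (unliftP ord0 i) => [j ->|->//]; rewrite tnthS.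
- exact: measurable_cube.
Qed.

End lebesgue_tuple.

Section sphere.
Context (R : realType) (d : nat).

Definition sqnorm (x : d.+1.-tuple R) : R := \sum_(i < d.+1) tnth x i ^+ 2.

Definition sphere_carrier := {u : d.+1.-tuple R | sqnorm u == 1}.

Fact north_pole_subproof :
  sqnorm [tuple ((i == ord0)%:R : R) | i < d.+1] == 1.
Proof.
rewrite /sqnorm big_ord_recl big1 ?tnth_mktuple ?eqxx ?expr1n ?addr0// => i _.
by rewrite tnth_mktuple expr0n.
Qed.

HB.instance Definition _ := Choice.on sphere_carrier.
HB.instance Definition _ := isPointed.Build sphere_carrier
  (exist (fun u => is_true (sqnorm u == 1)) _ north_pole_subproof).

Definition sphere_val (u : sphere_carrier) : d.+1.-tuple R := val u.

(* the unit sphere S^d of R^(d+1), with the Borel sigma-algebra induced by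
   R^(d+1) *)
Definition sphere := g_sigma_algebra_preimageType sphere_val.

HB.instance Definition _ := Measurable.on sphere.

Definition cone (A : set sphere) : set (d.+1.-tuple R) :=
  [set x | exists2 t : R, 0 < t <= 1 &
           exists2 u, A u & x = [tuple t * tnth (sphere_val u) i | i < d.+1]].

Definition cone_measure (A : set sphere) : \bar R := lebesgue_tuple (cone A).

Lemma measurable_sqnorm : measurable_fun setT sqnorm.
Proof.
apply: measurable_sum => i; apply: measurable_funX; exact: measurable_tnth.
Qed.

Definition dir (x : d.+1.-tuple R) : d.+1.-tuple R :=
  [tuple sqnorm x `^ (- 2^-1) * tnth x i | i < d.+1].

Lemma measurable_dir : measurable_fun setT dir.
Proof.
apply/measurable_fun_tnthP => i.
rewrite (_ : _ \o _ = fun x => sqnorm x `^ (- 2^-1) * tnth x i).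
  apply: measurable_funM; last exact: measurable_tnth.
  exact: (measurableT_comp (measurable_powR (- 2^-1)) measurable_sqnorm).
by apply/funext => x /=; rewrite tnth_mktuple.
Qed.

Lemma sqnormZ t x : sqnorm [tuple t * tnth x i | i < d.+1] = t ^+ 2 * sqnorm x.
Proof.
rewrite /sqnorm mulr_sumr; apply: eq_bigr => i _.
by rewrite tnth_mktuple exprMn.
Qed.

Lemma sqnorm_sphere (u : sphere) : sqnorm (sphere_val u) = 1.
Proof. by apply/eqP; exact: (valP (u : sphere_carrier)). Qed.

Lemma powR_half_inv (a : R) : 0 <= a -> (a ^+ 2) `^ (- 2^-1) = a^-1.
Proof.
by move=> a0; rewrite powRN powR12_sqrt ?sqr_ge0// sqrtr_sqr ger0_norm.
Qed.

Lemma sqnorm_dir x : 0 < sqnorm x -> sqnorm (dir x) = 1.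
Proof.
move=> x0; rewrite sqnormZ powRN powR12_sqrt ?ltW// exprVn sqr_sqrtr ?ltW//.
by rewrite mulVf// gt_eqF.
Qed.

Lemma dir_scale t (u : sphere) : 0 < t ->
  dir [tuple t * tnth (sphere_val u) i | i < d.+1] = sphere_val u.
Proof.
move=> t0; apply: eq_from_tnth => i; rewrite /dir sqnormZ sqnorm_sphere.
by rewrite !tnth_mktuple mulr1 powR_half_inv ?ltW// mulKf// gt_eqF.
Qed.

Lemma cone_preimage (B : set (d.+1.-tuple R)) :
  cone (sphere_val @^-1` B) =
  [set x | 0 < sqnorm x <= 1] `&` (dir @^-1` B).
Proof.
apply/seteqP; split => x /=.
  move=> [t /andP[t0 t1] [u Bu ->]]; rewrite dir_scale//; split => //.
  rewrite sqnormZ sqnorm_sphere mulr1 exprn_gt0//=.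
  by rewrite expr_le1// ltW.
move=> [/andP[x0 x1] Bx]; exists (Num.sqrt (sqnorm x)).
  by rewrite sqrtr_gt0 x0/= -[leRHS]sqrtr1 ler_sqrt.
exists (exist (fun u => is_true (sqnorm u == 1)) (dir x) (introT eqP (sqnorm_dir x0))) => //.
apply: eq_from_tnth => i; rewrite !tnth_mktuple powRN powR12_sqrt ?ltW//.
by rewrite mulVKf// gt_eqF// sqrtr_gt0.
Qed.

Lemma cone_setT : cone setT = [set x | 0 < sqnorm x <= 1].
Proof. by rewrite -(preimage_setT sphere_val) cone_preimage preimage_setT setIT. Qed.

Lemma measurable_cone (A : set sphere) : measurable A -> measurable (cone A).
Proof.
move=> [B mB <-]; rewrite setTI cone_preimage; apply: measurableI.
  rewrite (_ : [set _ | _] = sqnorm @^-1` `]0, 1]%classic).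
    rewrite -[X in measurable X]setTI.
    exact: (measurable_sqnorm measurableT (measurable_itv `]0, 1])).
  by apply/seteqP; split => x /=; rewrite in_itv.
by rewrite -[X in measurable X]setTI; exact: measurable_dir.
Qed.

Let cone_measure0 : cone_measure set0 = 0%E.
Proof.
rewrite /cone_measure (_ : cone set0 = set0) ?measure0//.
by apply/seteqP; split => // x [t _ []].
Qed.

Let cone_measure_ge0 A : (0 <= cone_measure A)%E.
Proof. exact: measure_ge0. Qed.

Let cone_measure_sigma_additive : semi_sigma_additive cone_measure.
Proof.
move=> F mF tF mUF; rewrite /cone_measure.
have coneU : cone (\bigcup_n F n) = \bigcup_n cone (F n).
  apply/seteqP; split => x /=.
    by move=> [t t01 [u [n _ Fu] xE]]; exists n => //; exists t => //; exists u.
  by move=> [n _ [t t01 [u Fu xE]]]; exists t => //; exists u => //; exists n.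
rewrite coneU; apply: measure_semi_sigma_additive.
- by move=> n; exact: (measurable_cone (mF n)).
- apply/trivIsetP => i j _ _ ij; apply/seteqP; split => // x.
  move=> [[t /andP[t0 _] [u Fu xE]] [s /andP[s0 _] [v Fv xE']]].
  have uv : u = v.
    by apply/val_inj; rewrite -[LHS](dir_scale u t0) -xE xE' dir_scale.
  have /trivIsetP/(_ i j I I ij) FiFj := tF.
  have : (F i `&` F j) u by split => //; rewrite uv.
  by rewrite FiFj.
- by rewrite -coneU; exact: measurable_cone.
Qed.

HB.instance Definition _ := isMeasure.Build _ _ _ cone_measure
  cone_measure0 cone_measure_ge0 cone_measure_sigma_additive.

Lemma cone_measure_setT_gt0 : (0 < cone_measure setT)%E.
Proof.
pose I : set R := `]0, d.+1%:R^-1]%classic.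
have Ic : lebesgue_measure I = (d.+1%:R^-1)%:E.
  by rewrite lebesgue_measure_itv/= lte_fin invr_gt0 ltr0n/= -EFinB subr0.
apply: (@lt_le_trans _ _ (d.+1%:R^-1 ^+ d.+1)%:E).
  by rewrite lte_fin exprn_gt0// invr_gt0 ltr0n.
rewrite -(lebesgue_tuple_cube _ _ Ic); last exact: measurable_itv.
apply: le_measure; rewrite ?inE.
- by apply: measurable_cube; exact: measurable_itv.
- exact: measurable_cone.
rewrite cone_setT => x /= Ix.
have x0 i : 0 < tnth x i by have := Ix i; rewrite /I/= in_itv/= => /andP[].
have x1 i : tnth x i <= d.+1%:R^-1.
  by have := Ix i; rewrite /I/= in_itv/= => /andP[].
apply/andP; split.
  rewrite /sqnorm big_ord_recl ltr_pwDl ?exprn_gt0//.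
  by apply: sumr_ge0 => i _; exact: sqr_ge0.
apply: (@le_trans _ _ (\sum_(i < d.+1) d.+1%:R^-1)); last first.
  by rewrite sumr_const card_ord -[X in X <= _]mulr_natl mulfV ?pnatr_eq0.
apply: ler_sum => i _; apply: le_trans (x1 i).
rewrite expr2 ler_piMr ?(ltW (x0 i))// (le_trans (x1 i))//.
by rewrite invf_le1 ?ltr0n// ler1n.
Qed.

Lemma cone_measure_setT_lty : (cone_measure setT < +oo)%E.
Proof.
pose I : set R := `[-1, 1]%classic.
have Ic : lebesgue_measure I = 2%:E.
  rewrite lebesgue_measure_itv/= lte_fin ifT; last by lra.
  by rewrite -EFinB; congr EFin; lra.
apply: (@le_lt_trans _ _ (2 ^+ d.+1)%:E); last by rewrite ltry.
rewrite -(lebesgue_tuple_cube _ _ Ic); last exact: measurable_itv.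
apply: le_measure; rewrite ?inE.
- exact: measurable_cone.
- by apply: measurable_cube; exact: measurable_itv.
rewrite cone_setT => x /= /andP[_ x1] i; rewrite /I/= in_itv/= -ler_norml.
rewrite -(@ler_pXn2r _ 2)// ?nnegrE// expr1n real_normK ?num_real//.
apply: le_trans x1; rewrite /sqnorm (bigD1 i)//= lerDl.
by apply: sumr_ge0 => j _; exact: sqr_ge0.
Qed.

(* The normalized surface measure, in its cone form: the surface measure of A is
   d.+1 times the volume of the part of the unit ball lying over A, and the
   factor d.+1 cancels in the normalization (cone setT is the closed unit ball
   minus the origin). *)
Definition uniform_sphere (A : set sphere) : \bar R :=
  ((fine (cone_measure setT))^-1%:E * cone_measure A)%E.

Let mass_inv_ge0 : 0 <= (fine (cone_measure setT))^-1.
Proof. by rewrite invr_ge0 fine_ge0. Qed.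

Let uniform_sphereE :
  uniform_sphere = mscale (NngNum mass_inv_ge0) cone_measure.
Proof. by []. Qed.

Let uniform_sphere0 : uniform_sphere set0 = 0%E.
Proof. by rewrite uniform_sphereE measure0. Qed.

Let uniform_sphere_ge0 A : (0 <= uniform_sphere A)%E.
Proof. by rewrite uniform_sphereE measure_ge0. Qed.

Let uniform_sphere_sigma_additive : semi_sigma_additive uniform_sphere.
Proof. by rewrite uniform_sphereE; exact: measure_semi_sigma_additive. Qed.

HB.instance Definition _ := isMeasure.Build _ _ _ uniform_sphere
  uniform_sphere0 uniform_sphere_ge0 uniform_sphere_sigma_additive.

Let uniform_sphere_setT : uniform_sphere setT = 1%E.
Proof.
rewrite /uniform_sphere -{2}[cone_measure setT]fineK.
  rewrite -EFinM mulVf// gt_eqF// fine_gt0//.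
  by rewrite cone_measure_setT_gt0 cone_measure_setT_lty.
by rewrite ge0_fin_numE ?cone_measure_setT_lty.
Qed.

HB.instance Definition _ := Measure_isProbability.Build _ _ _ uniform_sphere
  uniform_sphere_setT.

End sphere.

Section borel_complex.
Context (R : realType).

Definition borelC := g_sigma_algebraType (@open (R[i] : numFieldType)).

HB.instance Definition _ := Measurable.on borelC.

Lemma open_complex_box (a b : R) (U : set (R[i] : numFieldType)) :
  open U -> U (a +i* b) ->
  exists2 e : R, 0 < e & forall c d : R,
    `|a - c| < e -> `|b - d| < e -> U (c +i* d).
Proof.
move=> oU Uz; have /nbhs_ballP[e /= e0 zeU] := open_nbhs_nbhs (conj oU Uz).
have [r r0 eE] : exists2 r : R, 0 < r & e = r%:C.
  move: e0 {zeU}; case: e => x y; rewrite ltcE/= => /andP[/eqP -> x0].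
  by exists x.
exists (r / 2); first by rewrite divr_gt0.
move=> c d ac bd; apply: zeU; rewrite /ball/= /ball_/= eE normc_def ltcR/=.
rewrite -[ltRHS]ger0_norm ?ltW// -sqrtr_sqr ltr_sqrt ?exprn_gt0//.
have ac2 : (a - c) ^+ 2 < (r / 2) ^+ 2.
  by rewrite -(real_normK (num_real (a - c))) ltr_pXn2r ?nnegrE// divr_ge0// ltW.
have bd2 : (b - d) ^+ 2 < (r / 2) ^+ 2.
  by rewrite -(real_normK (num_real (b - d))) ltr_pXn2r ?nnegrE// divr_ge0// ltW.
nra.
Qed.

Lemma measurable_complex d (T : measurableType d) (f g : T -> R) :
  measurable_fun setT f -> measurable_fun setT g ->
  measurable_fun setT (fun x => f x +i* g x : borelC).
Proof.
move=> mf mg; apply: (@measurability _ _ T borelC setT _ (@open (R[i] : numFieldType))) => //.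
move=> _ [U oU <-]; rewrite setTI.
pose I (p : rat * rat) : set R := `]ratr p.1, ratr p.2[%classic.
pose F (p : (rat * rat) * (rat * rat)) : set T :=
  if `[< forall x y, I p.1 x -> I p.2 y -> U (x +i* y) >]
  then f @^-1` I p.1 `&` g @^-1` I p.2 else set0.
rewrite (_ : _ @^-1` _ = \bigcup_p F p).
  apply: countable_bigcupT_measurable => // p; rewrite /F; case: ifP => // _.
  apply: measurableI.
    by rewrite -[X in measurable X]setTI; apply: mf => //; exact: measurable_itv.
  by rewrite -[X in measurable X]setTI; apply: mg => //; exact: measurable_itv.
apply/seteqP; split => [t /= Ut|t /=]; last first.
  move=> [p _]; rewrite /F; case: ifPn => // /asboolP UI [If Ig]; exact: UI.
have [e e0 boxU] := open_complex_box oU Ut.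
have mid (x : R) : exists p, I p x /\ forall y, I p y -> `|x - y| < e.
  have [p1 p1x] := @rat_in_itvoo R (x - e / 2) x ltac:(lra).
  have [p2 p2x] := @rat_in_itvoo R x (x + e / 2) ltac:(lra).
  move: p1x p2x; rewrite !in_itv/= => /andP[? ?] /andP[? ?].
  exists (p1, p2); rewrite /I/= in_itv/=; split; first by apply/andP; split.
  by move=> y; rewrite /I/= in_itv/= ltr_norml => /andP[? ?]; apply/andP; split; lra.
have [p [pf pU]] := mid (f t); have [q [qg qU]] := mid (g t).
exists (p, q) => //; rewrite /F; case: ifPn => [//|/asboolP[]].
by move=> x y /pU ? /qU ?; exact: boxU.
Qed.

End borel_complex.

Section random_variables.
Context (R : realType) (n : nat).

(* z_j = x_j + i y_j, where R^(2n) has coordinates x_1, y_1, ..., x_n, y_n *)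
Definition zcoord (u : sphere R (2 * n).-1) (j : 'I_n) : R[i] :=
  tnth (sphere_val u) (inord (2 * j)) +i* tnth (sphere_val u) (inord (2 * j).+1).

Definition sum_sqr_zcoord (u : sphere R (2 * n).-1) : borelC R :=
  \sum_(j < n) zcoord u j ^+ 2.

Definition first_two_coord (u : sphere R n) : borelC R :=
  tnth (sphere_val u) (inord 0) +i* tnth (sphere_val u) (inord 1).

Lemma measurable_sphere_val d :
  measurable_fun setT (@sphere_val R d : sphere R d -> d.+1.-tuple R).
Proof. by move=> _ B mB; rewrite setTI; exists B => //; rewrite setTI. Qed.

Lemma measurable_sphere_coord d (i : 'I_d.+1) :
  measurable_fun setT (fun u : sphere R d => tnth (sphere_val u) i).
Proof. exact: (measurableT_comp (measurable_tnth i) (@measurable_sphere_val d)). Qed.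

Lemma sum_sqr_zcoordE (u : sphere R (2 * n).-1) :
  let x j := tnth (sphere_val u) (inord (2 * j)) in
  let y j := tnth (sphere_val u) (inord (2 * j).+1) in
  sum_sqr_zcoord u = (\sum_(j < n) (x j ^+ 2 - y j ^+ 2)) +i*
                     (\sum_(j < n) (2 * (x j * y j))).
Proof.
move=> x y; rewrite /sum_sqr_zcoord.
elim/big_rec3: _ => [//|j a b c _ ->].
rewrite /zcoord -/(x j) -/(y j) expr2; apply/eqP; rewrite eq_complex/=.
by apply/andP; split; apply/eqP; ring.
Qed.

Lemma measurable_sum_sqr_zcoord : measurable_fun setT sum_sqr_zcoord.
Proof.
rewrite (funext sum_sqr_zcoordE).
apply: measurable_complex; apply: measurable_sum => j.
  by apply: measurable_funB; apply: measurable_funX; exact: measurable_sphere_coord.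
apply: measurable_funM => //; apply: measurable_funM;
exact: measurable_sphere_coord.
Qed.

Lemma measurable_first_two_coord : measurable_fun setT first_two_coord.
Proof. by apply: measurable_complex; exact: measurable_sphere_coord. Qed.

HB.instance Definition _ :=
  isMeasurableFun.Build _ _ _ _ sum_sqr_zcoord measurable_sum_sqr_zcoord.

HB.instance Definition _ :=
  isMeasurableFun.Build _ _ _ _ first_two_coord measurable_first_two_coord.

End random_variables.

(* Main.v *)
(** In the coordinates [z = x + i y] of [R^n + i R^n], the variable is
    [|x|^2 - |y|^2 + 2 i x.y], and [|z|^2 = |x|^2 + |y|^2]. Rotating [y] so that
    [x] becomes [|x| e_1] (rotations preserve Lebesgue measure because they are
    products of shears), writing [|x| = exp t] and rescaling [y = u / (2 exp t)],
    Lebesgue measure on [R^(2n)] becomes, up to a constant, [dt du] on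
    [R * R^n], and the variable becomes [v + i u_1] with
    [v = exp (2 t) - |u|^2 exp (- 2 t) / 4], of radius [sqrt (v^2 + |u|^2)].
    Since [dt = dv / (2 sqrt (v^2 + |u|^2))], the triple
    [(Re sum z_j^2, Im sum z_j^2, |z|^2)] under Lebesgue measure is distributed as
    a multiple of [(w_1, w_2, |w|)] under the measure [dw / |w|] of [R^(n+1)].
    Both sides being homogeneous, integration in polar coordinates turns this
    identity into the equality of the laws on the spheres. *)
Require Import Defs.
From mathcomp Require Import all_boot all_order all_algebra.
From mathcomp Require Import complex.
From mathcomp Require Import all_classical all_reals all_analysis.
From mathcomp Require Import measurable_realfun.
From mathcomp Require Import ring lra.

Set Implicit Arguments.
Unset Strict Implicit.
Unset Printing Implicit Defensive.

Import Order.TTheory GRing.Theory Num.Theory.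
Import numFieldNormedType.Exports.

Local Open Scope classical_set_scope.
Local Open Scope ring_scope.
Local Open Scope ereal_scope.

(** * Restricted measures and measurable predicates *)

Lemma integral_mrestr d (T : measurableType d) (R : realType)
    (mu : {measure set T -> \bar R}) (D : set T) (mD : measurable D)
    (f : T -> \bar R) : measurable_fun setT f -> (forall x, 0 <= f x) ->
  \int[mrestr mu mD]_x f x = \int[mu]_(x in D) f x.
Proof.
move=> mf f0.
rewrite (@ge0_negligible_integral _ _ _ (mrestr mu mD) setT (~` D))//.
- rewrite setTD setCK; apply: eq_measure_integral => A mA AD.
  by rewrite /= /mrestr setIidl.
- exact: measurableC.
- by rewrite /= /mrestr setICl measure0.
Qed.

Lemma measurable_pred d (T : measurableType d) (b : T -> bool) :
  measurable_fun setT b -> measurable [set x | b x].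
Proof.
move=> mb; rewrite -[X in measurable X]setTI.
exact: (mb measurableT [set true]).
Qed.

(** * Reflection and translation invariance on the line *)

Section one_dim.
Context {R : realType}.
Notation mu := (@lebesgue_measure R).
Implicit Types f : R -> \bar R.

Lemma integral_pushforward_lebesgue (phi : R -> R) f :
  measurable_fun setT phi ->
  (forall A, measurable A -> mu A = mu (phi @^-1` A)) ->
  measurable_fun setT f -> (forall x, 0 <= f x) ->
  \int[mu]_x f (phi x) = \int[mu]_x f x.
Proof.
move=> mphi muphi mf f0.
rewrite -(@ge0_integral_pushforward _ _ (measurableTypeR R)
  (measurableTypeR R) R phi mphi mu setT f)//.
by apply: eq_measure_integral => A mA _; exact/esym/muphi.
Qed.

Lemma integral_lebesgue_opp f : measurable_fun setT f -> (forall x, 0 <= f x) ->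
  \int[mu]_x f (- x)%R = \int[mu]_x f x.
Proof.
apply: integral_pushforward_lebesgue => // A mA.
exact/esym/lebesgue_measureN.
Qed.

(** The pushforward of Lebesgue measure by a translation has the right value on half-open intervals,
    and these values determine Lebesgue measure. *)
Lemma integral_lebesgue_shift f c : measurable_fun setT f -> (forall x, 0 <= f x) ->
  \int[mu]_x f (x + c)%R = \int[mu]_x f x.
Proof.
have mphi : measurable_fun setT (fun x : R => x + c : measurableTypeR R)%R.
  exact: measurable_funD.
apply: integral_pushforward_lebesgue => // A mA.
pose nu : {measure set (measurableTypeR R) -> \bar R} :=
  measure_function_pushforward__canonical__measure_function_Measure mu mphi.
apply: (@lebesgue_measure_unique R nu) => // _ [[a b]] _ <- /=.
rewrite /pushforward (_ : _ @^-1` _ = (`](a - c)%R, (b - c)%R]%classic : set R)); last first.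
  by apply/seteqP; split => x /=; rewrite !in_itv/= ltrBlDr lerBrDr.
rewrite !lebesgue_measure_itv/= !lte_fin ltrD2r; case: ifP => // _.
by rewrite -!EFinB; congr EFin; lra.
Qed.

End one_dim.

(** * Change of variables along an increasing bijection of the line *)

Section change_of_variables.
Context {R : realType}.
Notation mu := (@lebesgue_measure R).
Variables (phi dphi psi : R -> R).
Hypothesis phi_deriv : forall x : R, is_derive x (1%R:R) phi (dphi x).
Hypothesis dphi_cont : continuous dphi.
Hypothesis dphi_ge0 : forall x, (0 <= dphi x)%R.
Hypothesis phi_mono : {mono phi : x y / (x <= y)%R}.
Hypothesis psiK : cancel psi phi.

(* The measure of density [dphi] is the pushforward by [fst] of the restriction
   of [mu \x mu] to the subgraph [D] of [dphi]. *)
Let D := [set p : measurableTypeR R * measurableTypeR R |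
  (0 <= p.2)%R && (p.2 < dphi p.1)%R].

Let mdphi : measurable_fun setT dphi.
Proof. exact: continuous_measurable_fun. Qed.

Let mphi : measurable_fun setT phi.
Proof.
apply: continuous_measurable_fun => x.
by apply/differentiable_continuous/derivable1_diffP; case: (phi_deriv x).
Qed.

Let mD : measurable D.
Proof.
apply: measurable_pred; apply: measurable_and.
  exact: measurable_fun_ler.
by apply: measurable_fun_ltr => //; exact: measurableT_comp.
Qed.

(** Tonelli: the fibre of [D] over [t] is the interval [[0, dphi t[], of length [dphi t]. *)
Let integral_subgraph f : measurable_fun setT f -> (forall x, 0 <= f x) ->
  \int[mu \x mu]_(p in D) f p.1 = \int[mu]_t (f t * (dphi t)%:E).
Proof.
move=> mf f0; rewrite integral_mkcond.
have mfD : measurable_fun setT ((fun p : measurableTypeR R * measurableTypeR R => f p.1) \_ D).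
  apply/measurable_restrict => //; rewrite setTI.
  exact/measurable_funTS/measurableT_comp.
have fD0 p : 0 <= ((fun p : measurableTypeR R * measurableTypeR R => f p.1) \_ D) p.
  by rewrite patchE; case: ifP.
rewrite fubini_tonelli1//; apply: eq_integral => t _; rewrite /fubini_F.
transitivity (\int[mu]_y ((cst (f t)) \_ (`[0%R, dphi t[%classic : set R)) y).
  apply: eq_integral => y _; rewrite !patchE.
  suff -> : ((t, y) \in D) = (y \in (`[0%R, dphi t[%classic : set R)) by [].
  by apply/idP/idP => /set_mem h; apply/mem_set; move: h; rewrite /D /= in_itv.
rewrite -integral_mkcond integral_cst//; congr (_ * _).
rewrite [LHS](@lebesgue_measure_itv R `[0%R, dphi t[)/= lte_fin.
have := dphi_ge0 t; rewrite le_eqVlt => /predU1P[<-|->]; first by rewrite ltxx.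
by rewrite oppr0 adde0.
Qed.

(** [phi] is an increasing bijection with inverse [psi]: [phi_mono] transports the order and [psiK]
    makes every endpoint a value of [phi]. *)
Let preimage_phi a b : phi @^-1` `]a, b]%classic = `]psi a, psi b]%classic.
Proof.
have -> : `]a, b]%classic = `]phi (psi a), phi (psi b)]%classic by rewrite !psiK.
by apply/seteqP; split => x /=; rewrite !in_itv/= phi_mono (leW_mono phi_mono).
Qed.

Let FTC_dphi a b : (a <= b)%R -> \int[mu]_(t in `]a, b]) (dphi t)%:E = (phi b - phi a)%:E.
Proof.
rewrite le_eqVlt => /predU1P[->|ab].
  by rewrite set_itvoc0 integral_set0 subrr.
rewrite integral_itv_obnd_cbnd; last exact/measurable_EFinP/measurable_funTS.
have cphi : continuous phi.
  move=> x; apply/differentiable_continuous/derivable1_diffP.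
  by case: (phi_deriv x).
rewrite (@continuous_FTC2 _ _ phi)//.
- exact: continuous_subspaceT.
- split.
  + by move=> x _; case: (phi_deriv x).
  + exact/cvg_at_right_filter/cphi.
  + exact/cvg_at_left_filter/cphi.
- by move=> x _; rewrite derive1E derive_val.
Qed.

Let mphi1 : measurable_fun setT
  (fun p : measurableTypeR R * measurableTypeR R => phi p.1 : measurableTypeR R).
Proof. exact: measurableT_comp. Qed.

Let rho : {measure set (measurableTypeR R * measurableTypeR R)%type -> \bar R} :=
  mrestr (mu \x mu) mD.

Let nu : {measure set (measurableTypeR R) -> \bar R} :=
  measure_function_pushforward__canonical__measure_function_Measure rho mphi1.

Let integral_nu f : measurable_fun setT f -> (forall x, 0 <= f x) ->
  \int[nu]_x f x = \int[mu]_t (f (phi t) * (dphi t)%:E).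
Proof.
move=> mf f0; rewrite ge0_integral_pushforward//= integral_mrestr//.
- rewrite (integral_subgraph (f := f \o phi))//.
    exact: (measurableT_comp mf mphi).
  by move=> x; exact: f0.
- exact: (measurableT_comp mf mphi1).
Qed.

(** The right side is the integral of [f] against [nu], the image by [phi] of the density [dphi]. By
    the fundamental theorem of calculus [nu] gives []a, b]] the mass
    [phi (psi b) - phi (psi a) = b - a], hence [nu] is Lebesgue measure. *)
Lemma change_of_variables f : measurable_fun setT f -> (forall x, 0 <= f x) ->
  \int[mu]_x f x = \int[mu]_t (f (phi t) * (dphi t)%:E).
Proof.
move=> mf f0; rewrite -integral_nu//; apply: eq_measure_integral => A mA _.
apply: (@lebesgue_measure_unique R nu) => // _ [[a b]] _ <-; rewrite [(_, _).1]/= [(_, _).2]/=.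
set I : set R := `]a, b]%classic.
have mI : measurable I by exact: measurable_itv.
transitivity (\int[nu]_x (\1_I x)%:E); last by rewrite integral_indic// setIT.
rewrite integral_nu//; last exact/measurable_EFinP/measurable_indic.
transitivity (\int[mu]_(t in `]psi a, psi b]) (dphi t)%:E); last first.
  rewrite integral_mkcond -preimage_phi; apply: eq_integral => t _.
  rewrite patchE indicE; case: ifPn => [/set_mem It|/negP It].
    by rewrite mem_set// mul1e.
  by rewrite memNset ?mul0e// => It'; apply/It/mem_set.
rewrite [LHS](@lebesgue_measure_itv R `]a, b])/= lte_fin; have [ab|ba] := ltP a b.
  rewrite FTC_dphi ?psiK ?EFinB// -phi_mono !psiK; exact: ltW.
by rewrite set_itv_ge ?integral_set0// -leNgt bnd_simp -phi_mono !psiK.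
Qed.
End change_of_variables.

(** * Measurability and Tonelli for curried functions *)

Section curried.
Context {R : realType}.

(** Integrands are kept curried, with joint measurability stated on products; this form and the next
    one discharge the side conditions that result. *)
Lemma measurable_comp2 d1 d2 d3 d4 (T : measurableType d1) (X : measurableType d2)
    (Y : measurableType d3) (Z : measurableType d4) (f : X -> Y -> Z)
    (u : T -> X) (v : T -> Y) :
  measurable_fun setT (fun p : X * Y => f p.1 p.2) ->
  measurable_fun setT u -> measurable_fun setT v ->
  measurable_fun setT (fun x => f (u x) (v x)).
Proof.
move=> mf mu mv.
exact: (measurableT_comp mf (measurable_fun_pair mu mv)).
Qed.

Lemma measurable_comp3 d d1 d2 d3 d4 (T : measurableType d) (X : measurableType d1)
    (Y : measurableType d2) (Z : measurableType d3) (W : measurableType d4)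
    (f : X -> Y -> Z -> W) (u : T -> X) (v : T -> Y) (w : T -> Z) :
  measurable_fun setT (fun p : (X * Y) * Z => f p.1.1 p.1.2 p.2) ->
  measurable_fun setT u -> measurable_fun setT v -> measurable_fun setT w ->
  measurable_fun setT (fun x => f (u x) (v x) (w x)).
Proof.
move=> mf mu mv mw.
exact: (measurableT_comp mf (measurable_fun_pair (measurable_fun_pair mu mv) mw)).
Qed.

Context d1 d2 (T1 : measurableType d1) (T2 : measurableType d2).
Variables (m1 : {sigma_finite_measure set T1 -> \bar R})
  (m2 : {sigma_finite_measure set T2 -> \bar R}).
Variable f : T1 -> T2 -> \bar R.
Hypothesis mf : measurable_fun setT (fun p : T1 * T2 => f p.1 p.2).
Hypothesis f0 : forall x y, 0 <= f x y.

Lemma measurable_integral : measurable_fun setT (fun x => \int[m2]_y f x y).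
Proof. exact: (@measurable_fun_fubini_tonelli_F _ _ _ _ _ m2 _ mf (fun p => f0 p.1 p.2)). Qed.

Lemma tonelli : \int[m1]_x \int[m2]_y f x y = \int[m2]_y \int[m1]_x f x y.
Proof. exact: (@fubini_tonelli _ _ _ _ _ m1 m2 _ mf (fun p => f0 p.1 p.2)). Qed.

End curried.

(** * Shears of the plane *)

Section plane.
Context {R : realType}.
Notation mu := (@lebesgue_measure R).
Notation mR := (measurableTypeR R).
Variable M : R -> R -> \bar R.
Hypothesis mM : measurable_fun setT (fun p : mR * mR => M p.1 p.2).
Hypothesis M0 : forall a b, 0 <= M a b.

(** For fixed [b] the shear is a translation of [a]; Tonelli makes [a] the inner variable. *)
Lemma integral_shear1 t :
  \int[mu]_a \int[mu]_b M (a + t * b) b = \int[mu]_a \int[mu]_b M a b.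
Proof.
rewrite tonelli//; last first.
  apply: (measurable_comp2 mM) => //.
  by apply: measurable_funD => //; exact: measurable_funM.
rewrite [RHS]tonelli//; apply: eq_integral => b _.
by rewrite (integral_lebesgue_shift (f := M ^~ b))//; apply: (measurable_comp2 mM).
Qed.

Lemma integral_shear2 t :
  \int[mu]_a \int[mu]_b M a (b + t * a) = \int[mu]_a \int[mu]_b M a b.
Proof.
apply: eq_integral => a _.
by rewrite (integral_lebesgue_shift (f := M a))//; apply: (measurable_comp2 mM).
Qed.

End plane.

(** * Rotations of the plane *)

Section rotation.
Context {R : realType}.
Notation mu := (@lebesgue_measure R).
Notation mR := (measurableTypeR R).
Variable M : R -> R -> \bar R.
Hypothesis mM : measurable_fun setT (fun p : mR * mR => M p.1 p.2).
Hypothesis M0 : forall a b, 0 <= M a b.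

(* A rotation of angle t != pi is a product of three shears, of slopes
   tan (t / 2), - sin t and tan (t / 2). *)
Lemma integral_rotation (c s : R) : (c ^+ 2 + s ^+ 2 = 1)%R ->
  \int[mu]_a \int[mu]_b M (c * a + s * b)%R (c * b - s * a)%R =
  \int[mu]_a \int[mu]_b M a b.
Proof.
(* The half-turn, where the half-angle tangent is undefined, is handled as one reflection in each
   coordinate. *)
move=> cs; have [cN1|cN1] := eqVneq c (-1)%R.
  have -> : s = 0%R.
    by apply/eqP; rewrite -sqrf_eq0; apply/eqP; move: cs; rewrite cN1; lra.
  rewrite cN1; under eq_integral do under eq_integral do
    rewrite !mul0r addr0 subr0 !mulN1r.
  rewrite (integral_lebesgue_opp (f := fun a => \int[mu]_b M a (- b)%R)); last 2 first.
  - apply: measurable_integral => //; apply: (measurable_comp2 mM) => //; exact: measurable_funN.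
  - by move=> a /=; apply: integral_ge0 => b _; exact: M0.
  apply: eq_integral => a _; rewrite (integral_lebesgue_opp (f := M a))//.
  exact: (measurable_comp2 mM).
(* [t] is the tangent of the half angle; [ts] and [tc] are the identities that make the three shears
   compose to the rotation. *)
pose t := (s / (1 + c))%R.
have c1 : (1 + c != 0)%R by apply: contra_neq cN1 => /eqP; rewrite addrC addr_eq0 => /eqP.
have ts : (t * s = 1 - c)%R.
  by apply: (mulIf c1); rewrite /t mulrAC divfK//; move: cs; nra.
have tc : (t + t * c = s)%R by rewrite /t; field.
rewrite -(integral_shear1 mM M0 t).
rewrite -(@integral_shear2 _ (fun a b => M (a + t * b)%R b) _ _ (- s)%R); last 2 first.
- apply: (measurable_comp2 mM) => //.
  by apply: measurable_funD => //; exact: measurable_funM.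
- by move=> *; exact: M0.
rewrite -(@integral_shear1 _
  (fun a b => M (a + t * (b + - s * a))%R (b + - s * a)%R) _ _ t); last 2 first.
- apply: (measurable_comp2 mM).
    apply: measurable_funD => //; apply: measurable_funM => //.
    by apply: measurable_funD => //; exact: measurable_funM.
  by apply: measurable_funD => //; exact: measurable_funM.
- by move=> *; exact: M0.
apply: eq_integral => a _; apply: eq_integral => b _; congr M.
  by rewrite -[in LHS]tc -[c in LHS](subKr 1%R) -ts; ring.
by rewrite -[c in LHS](subKr 1%R) -ts; ring.
Qed.

End rotation.

(** * Lebesgue measure on tuples: slicing, scaling, squared norm *)

Section tuples.
Context {R : realType}.
Notation mu := (@lebesgue_measure R).
Notation mR := (measurableTypeR R).
Notation L n := (@lebesgue_tuple R n).

Lemma integral_lebesgue_tuple0 (F : 0.-tuple R -> \bar R) :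
  measurable_fun setT F -> \int[L 0%N]_x F x = F [tuple].
Proof.
move=> mF; rewrite (@eq_measure_integral _ _ _ setT \d_([tuple] : 0.-tuple R))//.
by rewrite integral_dirac// diracT mul1e.
Qed.

Lemma integral_lebesgue_tuple_cons n (F : n.+1.-tuple R -> \bar R) :
  measurable_fun setT F -> (forall x, 0 <= F x) ->
  \int[L n.+1]_x F x = \int[mu]_a \int[L n]_t F [tuple of a :: t].
Proof.
move=> mF F0.
pose nu : {measure set (n.+1.-tuple R) -> \bar R} :=
  measure_function_pushforward__canonical__measure_function_Measure
    (mu \x L n) (@measurable_tcons R n).
rewrite (@eq_measure_integral _ _ _ setT nu)//.
rewrite ge0_integral_pushforward//=; last exact: measurable_tcons.
rewrite fubini_tonelli1//.
exact: (measurableT_comp mF (@measurable_tcons R n)).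
Qed.

Lemma measurable_cons_comp d d' (T : measurableType d) (Z : measurableType d') n
    (F : n.+1.-tuple R -> Z) (u : T -> R) (v : T -> n.-tuple R) :
  measurable_fun setT F -> measurable_fun setT u -> measurable_fun setT v ->
  measurable_fun setT (fun x => F [tuple of u x :: v x]).
Proof.
move=> mF mu_ mv; apply: (measurableT_comp mF).
exact: (measurableT_comp (@measurable_tcons R n) (measurable_fun_pair mu_ mv)).
Qed.

Definition scale n (r : R) (x : n.-tuple R) : n.-tuple R :=
  [tuple (r * tnth x i)%R | i < n].

Lemma measurable_scale2 n :
  measurable_fun setT (fun p : mR * n.-tuple R => scale p.1 p.2).
Proof.
apply/measurable_fun_tnthP => i.
rewrite (_ : _ \o _ = fun p : mR * n.-tuple R => (p.1 * tnth p.2 i)%R).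
  apply: measurable_funM => //.
  exact: (measurableT_comp (measurable_tnth i)).
by apply/funext => x /=; rewrite tnth_mktuple.
Qed.

Lemma measurable_scale n r : measurable_fun setT (@scale n r).
Proof.
exact: (measurable_comp2 (@measurable_scale2 n)).
Qed.

Lemma scale_cons n r a (x : n.-tuple R) :
  scale r [tuple of a :: x] = [tuple of (r * a)%R :: scale r x].
Proof.
apply: eq_from_tnth => i; rewrite tnth_mktuple.
by case: (unliftP ord0 i) => [j ->|->//]; rewrite !tnthS tnth_mktuple.
Qed.

Lemma integral_scaleR (f : R -> \bar R) r : (0 < r)%R ->
  measurable_fun setT f -> (forall x, 0 <= f x) ->
  r%:E * \int[mu]_x f (r * x)%R = \int[mu]_x f x.
Proof.
move=> r0 mf f0; rewrite [RHS](@change_of_variables _ ( *%R r) (cst r) ( *%R r^-1))//.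
- rewrite -ge0_integralZl//=; last 2 first.
  + exact: (measurableT_comp mf (measurable_funM _ _)).
  + by rewrite lee_fin ltW.
  by apply: eq_integral => x _; rewrite muleC.
- by move=> x; apply: is_derive_eq; rewrite /GRing.scale/= mulr1.
- exact: cst_continuous.
- by move=> _ /=; exact: ltW.
- by move=> x y; rewrite ler_pM2l.
- by move=> x; rewrite mulrA divff ?mul1r// gt_eqF.
Qed.

(** Induction on the dimension: every coordinate contributes one factor [r]. *)
Lemma integral_scale n (F : n.-tuple R -> \bar R) r : (0 < r)%R ->
  measurable_fun setT F -> (forall x, 0 <= F x) ->
  (r ^+ n)%:E * \int[L n]_x F (scale r x) = \int[L n]_x F x.
Proof.
move=> r0; elim: n F => [|n IH] F mF F0.
  rewrite expr0 mul1e; apply: eq_integral => x _.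
  by congr F; apply: eq_from_tnth => -[].
have mFs : measurable_fun setT (fun x => F (scale r x)).
  exact: (measurableT_comp mF (measurable_scale r)).
rewrite !integral_lebesgue_tuple_cons//.
have mG : measurable_fun setT
    (fun p : mR * n.-tuple R => F [tuple of p.1 :: scale r p.2]).
  apply: measurable_cons_comp => //.
  exact: (measurableT_comp (measurable_scale r)).
under [RHS]eq_integral => a _.
  rewrite -(IH (fun t => F [tuple of a :: t]))//; last exact: measurable_cons_comp.
  over.
rewrite ge0_integralZl//; last 3 first.
- exact: measurable_integral.
- by move=> a _; exact: integral_ge0.
- by rewrite lee_fin exprn_ge0// ltW.
rewrite -(@integral_scaleR (fun a => \int[L n]_t F [tuple of a :: scale r t]) r)//.
- rewrite exprSr EFinM -muleA; congr (_ * (_ * _)).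
  by apply: eq_integral => a _; apply: eq_integral => t _; rewrite scale_cons.
- exact: measurable_integral.
- by move=> a; exact: integral_ge0.
Qed.

Definition dot n (x y : n.-tuple R) : R := (\sum_(i < n) tnth x i * tnth y i)%R.
Definition sq n (x : n.-tuple R) : R := (\sum_(i < n) tnth x i ^+ 2)%R.

Lemma sq_ge0 n (x : n.-tuple R) : (0 <= sq x)%R.
Proof. by apply: sumr_ge0 => i _; exact: sqr_ge0. Qed.

Lemma sq_cons n a (x : n.-tuple R) : sq [tuple of a :: x] = (a ^+ 2 + sq x)%R.
Proof.
by rewrite /sq big_ord_recl; congr +%R; apply: eq_bigr => i _; rewrite tnthS.
Qed.

Lemma dot_cons n a b (x y : n.-tuple R) :
  dot [tuple of a :: x] [tuple of b :: y] = (a * b + dot x y)%R.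
Proof.
by rewrite /dot big_ord_recl; congr +%R; apply: eq_bigr => i _; rewrite !tnthS.
Qed.

Lemma sq_scale n r (x : n.-tuple R) : sq (scale r x) = (r ^+ 2 * sq x)%R.
Proof.
by rewrite /sq mulr_sumr; apply: eq_bigr => i _; rewrite tnth_mktuple exprMn.
Qed.

Lemma measurable_sq n : measurable_fun setT (@sq n).
Proof.
apply: measurable_sum => i; apply: measurable_funX; exact: measurable_tnth.
Qed.

Lemma measurable_dot n :
  measurable_fun setT (fun p : n.-tuple R * n.-tuple R => dot p.1 p.2).
Proof.
apply: measurable_sum => i; apply: measurable_funM.
  exact: (measurableT_comp (measurable_tnth i)).
exact: (measurableT_comp (measurable_tnth i)).
Qed.

(** The set is the cube of side [[set 0]], of volume [0 ^+ n.+1]. The dimension must be positive: in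
    dimension 0 the single point has mass 1. *)
Lemma lebesgue_tuple_sq0 n : L n.+1 [set x | sq x = 0%R] = 0.
Proof.
rewrite -[RHS]/((0 : R)%:E) -[X in X%:E](expr0n R n.+1).
rewrite -(@lebesgue_tuple_cube R n.+1 [set 0%R] 0%R).
- congr (L n.+1 _); apply/seteqP; split => x /=.
    move=> /eqP; rewrite psumr_eq0; last by move=> i _; exact: sqr_ge0.
    by move=> /allP h i; apply/eqP; rewrite -sqrf_eq0; exact/h/mem_index_enum.
  by move=> h; rewrite /sq big1// => i _; rewrite h expr0n.
- exact: measurable_set1.
- exact: lebesgue_measure_set1.
Qed.

End tuples.

(** * Rotation invariance in higher dimension, real and imaginary parts *)

Section gram.
Context {R : realType}.
Notation mu := (@lebesgue_measure R).
Notation mR := (measurableTypeR R).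
Notation L n := (@lebesgue_tuple R n).

(** [p a + q b] is [r = sqrt (p^2 + q^2)] times the first coordinate of a rotation of [(a, b)], and
    [a^2 + b^2] is invariant under it. *)
Lemma integral_rotation_dot (K : R -> R -> \bar R) (p q : R) :
  measurable_fun setT (fun z : mR * mR => K z.1 z.2) ->
  (forall a b, 0 <= K a b) ->
  \int[mu]_a \int[mu]_b K (p * a + q * b)%R (a ^+ 2 + b ^+ 2)%R =
  \int[mu]_a \int[mu]_b K (Num.sqrt (p ^+ 2 + q ^+ 2) * a)%R (a ^+ 2 + b ^+ 2)%R.
Proof.
move=> mK K0; set r := Num.sqrt _.
have r2 : (r ^+ 2 = p ^+ 2 + q ^+ 2)%R by rewrite sqr_sqrtr// addr_ge0 ?sqr_ge0.
(* No angle is defined when [r = 0], but then [p = q = 0] and the two sides coincide. *)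
have [r0|r0] := eqVneq r 0%R.
  move: r2; rewrite r0 expr0n/= => /esym/eqP; rewrite paddr_eq0 ?sqr_ge0//.
  by rewrite !sqrf_eq0 => /andP[/eqP -> /eqP ->]; under eq_integral do
    under eq_integral do rewrite !mul0r addr0; under [RHS]eq_integral do
    under eq_integral do rewrite mul0r.
rewrite -(@integral_rotation _ (fun a b => K (r * a)%R (a ^+ 2 + b ^+ 2)%R)
  _ _ (p / r) (q / r))%R//.
- apply: eq_integral => a _; apply: eq_integral => b _; congr K.
    by field.
  have pq : ((p / r) ^+ 2 + (q / r) ^+ 2 = 1)%R.
    by rewrite !expr_div_n -mulrDl -r2 divff// expf_neq0.
  rewrite -[LHS]mul1r -pq; ring.
- apply: (measurable_comp2 mK); first exact: measurable_funM.
  by apply: measurable_funD; apply: measurable_funX.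
- by rewrite !expr_div_n -mulrDl -r2 divff// expf_neq0.
Qed.

(** Induction on the dimension replaces a rotation taking [x] to [|x| e_1]. With [x] split as
    [a :: x] and [y] as [b :: t], the induction hypothesis turns [dot x t] into [|x| c], where [c]
    is the head of [t], and a planar rotation of [(b, c)] turns [a b + |x| c] into
    [sqrt (a^2 + |x|^2) b]. *)
Lemma integral_dot n (x : n.+1.-tuple R) (H : R -> R -> \bar R) :
  measurable_fun setT (fun z : mR * mR => H z.1 z.2) ->
  (forall a b, 0 <= H a b) ->
  \int[L n.+1]_y H (dot x y) (sq y) =
  \int[L n.+1]_y H (Num.sqrt (sq x) * thead y)%R (sq y).
Proof.
have mdot m (z : m.-tuple R) : measurable_fun setT (dot z).
  exact: (measurable_comp2 (@measurable_dot R m)).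
have mthead m : measurable_fun setT (@thead m R) by exact: measurable_tnth.
have mL m (z : m.+1.-tuple R) (G : R -> R -> \bar R) :
    measurable_fun setT (fun z : mR * mR => G z.1 z.2) ->
    measurable_fun setT (fun y : m.+1.-tuple R => G (dot z y) (sq y)).
  by move=> mG; apply: (measurable_comp2 mG); [exact: mdot|exact: measurable_sq].
have mRt m r (G : R -> R -> \bar R) :
    measurable_fun setT (fun z : mR * mR => G z.1 z.2) ->
    measurable_fun setT (fun y : m.+1.-tuple R => G (r * thead y)%R (sq y)).
  move=> mG; apply: (measurable_comp2 mG); last exact: measurable_sq.
  by apply: measurable_funM; [exact: measurable_cst|exact: mthead].
elim: n x H => [|n IH] x H mH H0; case/tupleP: x => a x.
  rewrite !integral_lebesgue_tuple_cons//; [|exact: mRt|exact: mL].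
  pose G c := \int[L 0%N]_t H (a * c)%R (c ^+ 2)%R.
  transitivity (\int[mu]_c G c).
    apply: eq_integral => c _; apply: eq_integral => t _.
    by rewrite dot_cons sq_cons /dot /sq !big_ord0 !addr0.
  transitivity (\int[mu]_c \int[L 0%N]_t H (`|a| * c)%R (c ^+ 2)%R); last first.
    apply: eq_integral => c _; apply: eq_integral => t _.
    by rewrite theadE !sq_cons /sq !big_ord0 !addr0 sqrtr_sqr.
  (* In dimension one only the sign of [a] has to be removed, by a reflection. *)
  have [a0|a0] := leP 0%R a; first by rewrite ger0_norm.
  rewrite -(integral_lebesgue_opp (f := G)).
  - apply: eq_integral => c _; rewrite /G; apply: eq_integral => t _.
    by rewrite ltr0_norm// mulrN mulNr sqrrN.
  - apply: measurable_integral => //; apply: (measurable_comp2 mH).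
      by apply: measurable_funM => //; exact: measurable_fst.
    by apply: measurable_funX; exact: measurable_fst.
  - by move=> c; exact: integral_ge0.
(* [K] integrates out the coordinates other than [b] and [c], which enter only through their sum of
   squares. *)
pose K u v := \int[L n]_t H u (v + sq t)%R.
have mK : measurable_fun setT (fun z : mR * mR => K z.1 z.2).
  apply: (@measurable_integral R _ _ _ _ (L n) (fun (z : mR * mR) t => H z.1 (z.2 + sq t)%R)) => //.
  apply: (measurable_comp2 mH).
    exact: (measurableT_comp measurable_fst).
  apply: measurable_funD.
    exact: (measurableT_comp measurable_snd).
  exact: (measurableT_comp (@measurable_sq _ _)).
have K0 u v : 0 <= K u v by exact: integral_ge0.
rewrite !integral_lebesgue_tuple_cons//; [|exact: mRt|exact: mL].
have mHa b : measurable_fun setT (fun z : mR * mR => H (a * b + z.1)%R (b ^+ 2 + z.2)%R).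
  by apply: (measurable_comp2 mH); exact: measurable_funD.
transitivity (\int[mu]_b \int[mu]_c K (a * b + Num.sqrt (sq x) * c)%R (b ^+ 2 + c ^+ 2)%R).
  apply: eq_integral => b _.
  transitivity (\int[L n.+1]_t H (a * b + dot x t)%R (b ^+ 2 + sq t)%R).
    by apply: eq_integral => t _; rewrite dot_cons sq_cons.
  rewrite (IH x (fun u v => H (a * b + u)%R (b ^+ 2 + v)%R))//.
  rewrite integral_lebesgue_tuple_cons//.
    apply: eq_integral => c _; apply: eq_integral => t _.
    by rewrite theadE sq_cons addrA.
  exact: (mRt _ _ (fun u v => H (a * b + u)%R (b ^+ 2 + v)%R)).
rewrite integral_rotation_dot// sqr_sqrtr ?sq_ge0//.
apply: eq_integral => b _; rewrite integral_lebesgue_tuple_cons//.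
  apply: eq_integral => c _; apply: eq_integral => t _.
  by rewrite theadE !sq_cons addrA.
apply: (measurable_cons_comp
  (F := fun y => H (Num.sqrt (sq [tuple of a :: x]) * thead y)%R (sq y))) => //.
exact: mRt.
Qed.

(** The real parts [x_j] of a point of [C^n]; [odds] gives the imaginary parts. The length [N] is
    free, with [nth] defaulting to 0, so that it can be [(2 * n).-1.+1] as well as [n.*2]. *)
Definition evens n N (z : N.-tuple R) : n.-tuple R := [tuple nth 0%R z (2 * i) | i < n].
Definition odds n N (z : N.-tuple R) : n.-tuple R := [tuple nth 0%R z (2 * i).+1 | i < n].

Lemma measurable_nth N k : measurable_fun setT (fun z : N.-tuple R => nth 0%R z k).
Proof.
have [kN|Nk] := ltnP k N; last first.
  rewrite (_ : (fun _ => _) = cst 0%R); first exact: measurable_cst.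
  by apply/funext => z; rewrite nth_default// size_tuple.
rewrite (_ : (fun _ => _) = @tnth N R ^~ (Ordinal kN)).
  exact: measurable_tnth.
by apply/funext => z; rewrite (tnth_nth 0%R).
Qed.

Lemma measurable_evens n N : measurable_fun setT (@evens n N).
Proof.
apply/measurable_fun_tnthP => i.
rewrite (_ : _ \o _ = fun z : N.-tuple R => nth 0%R z (2 * i)).
  exact: measurable_nth.
by apply/funext => z /=; rewrite tnth_mktuple.
Qed.

Lemma measurable_odds n N : measurable_fun setT (@odds n N).
Proof.
apply/measurable_fun_tnthP => i.
rewrite (_ : _ \o _ = fun z : N.-tuple R => nth 0%R z (2 * i).+1).
  exact: measurable_nth.
by apply/funext => z /=; rewrite tnth_mktuple.
Qed.

Lemma evens_cons n N a b (z : N.-tuple R) :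
  evens n.+1 [tuple of a :: [tuple of b :: z]] = [tuple of a :: evens n z].
Proof.
apply: eq_from_tnth => i; rewrite tnth_mktuple.
case: (unliftP ord0 i) => [j ->|->]; last by rewrite muln0.
by rewrite tnthS tnth_mktuple lift0 mulnS.
Qed.

Lemma odds_cons n N a b (z : N.-tuple R) :
  odds n.+1 [tuple of a :: [tuple of b :: z]] = [tuple of b :: odds n z].
Proof.
apply: eq_from_tnth => i; rewrite tnth_mktuple.
case: (unliftP ord0 i) => [j ->|->]; last by rewrite muln0.
by rewrite tnthS tnth_mktuple lift0 mulnS.
Qed.

(** Coordinates are peeled off two at a time: [a] goes to the first vector and [b] to the second. *)
Lemma integral_evens_odds n N (F : n.-tuple R -> n.-tuple R -> \bar R) :
  N = n.*2 ->
  measurable_fun setT (fun p : n.-tuple R * n.-tuple R => F p.1 p.2) ->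
  (forall x y, 0 <= F x y) ->
  \int[L N]_z F (evens n z) (odds n z) = \int[L n]_x \int[L n]_y F x y.
Proof.
elim: n N F => [|n IH] N F; rewrite ?double0 ?doubleS => -> mF F0.
  rewrite integral_lebesgue_tuple0; last first.
    by apply: (measurable_comp2 mF); [exact: measurable_evens|exact: measurable_odds].
  rewrite integral_lebesgue_tuple0; last exact: measurable_integral.
  rewrite integral_lebesgue_tuple0; last exact: (measurable_comp2 mF).
  by congr F; apply: eq_from_tnth => -[].
have mF1 : measurable_fun setT
    (fun x : n.*2.+2.-tuple R => F (evens n.+1 x) (odds n.+1 x)).
  by apply: (measurable_comp2 mF); [exact: measurable_evens|exact: measurable_odds].
have mF2 : measurable_fun setT (fun x => \int[L n.+1]_y F x y).
  exact: measurable_integral.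
rewrite !integral_lebesgue_tuple_cons//; last by move=> x; exact: integral_ge0.
apply: eq_integral => a _; rewrite integral_lebesgue_tuple_cons//; last first.
  exact: (measurable_cons_comp (F := fun x => F (evens n.+1 x) (odds n.+1 x))).
transitivity (\int[mu]_b \int[L n]_x \int[L n]_y F [tuple of a :: x] [tuple of b :: y]).
  apply: eq_integral => b _.
  rewrite -(IH n.*2 (fun x y => F [tuple of a :: x] [tuple of b :: y]))//.
    by apply: eq_integral => z _; rewrite evens_cons odds_cons.
  by apply: (measurable_comp2 mF); apply: (measurable_cons_comp (F := id)).
(* The integral in [b] passes inside the one in [x], where [b] becomes the head of the second
   vector. *)
rewrite tonelli//.
- apply: eq_integral => x _; rewrite integral_lebesgue_tuple_cons//.
  apply: (measurable_comp2 mF) => //; exact: (measurable_cons_comp (F := id)).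
- apply: (@measurable_integral R _ _ _ _ (L n) (fun (p : mR * n.-tuple R) y =>
     F [tuple of a :: p.2] [tuple of p.1 :: y])) => //.
  apply: (measurable_comp2 mF); apply: (measurable_cons_comp (F := id)) => //.
    exact: (measurableT_comp measurable_snd).
  exact: (measurableT_comp measurable_fst).
- by move=> b x; exact: integral_ge0.
Qed.

End gram.

(** * Polar coordinates with a logarithmic radius *)

Section polar.
Context {R : realType}.
Notation mu := (@lebesgue_measure R).
Notation mR := (measurableTypeR R).
Notation L n := (@lebesgue_tuple R n).

(** The logarithm of the Euclidean norm, meaningful off the origin: dilations become translations,
    so that translation invariance on the line applies to the radius. *)
Definition lognorm n (x : n.-tuple R) : R := (ln (sq x) / 2)%R.

Lemma measurable_lognorm n : measurable_fun setT (@lognorm n).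
Proof.
apply: measurable_funM => //.
exact: (measurableT_comp (@measurable_ln R) (@measurable_sq R n)).
Qed.

Lemma expR_lognorm n (x : n.-tuple R) : (0 < sq x)%R ->
  expR (lognorm x) = Num.sqrt (sq x).
Proof.
move=> x0; apply: (pexpIrn (n := 2)); rewrite ?nnegrE ?expR_ge0 ?sqrtr_ge0//.
by rewrite sqr_sqrtr ?ltW// -expRM_natl /lognorm mulrC divfK// lnK// posrE.
Qed.

Lemma lognorm_scale n t (x : n.-tuple R) : (0 < sq x)%R ->
  lognorm (scale (expR t) x) = (t + lognorm x)%R.
Proof.
move=> x0; rewrite /lognorm sq_scale lnM ?posrE ?exprn_gt0 ?expR_gt0//.
by rewrite -expRM_natl expRK; field.
Qed.

Variables (n : nat) (A : set (n.-tuple R)).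
Hypotheses (mA : measurable A) (A_gt0 : forall x, A x -> (0 < sq x)%R)
  (A_scale : forall r x, (0 < r)%R -> A (scale r x) <-> A x).

Let I : set R := `]0%R, 1%R]%classic.
Let mI : measurable I. Proof. exact: measurable_itv. Qed.

(** The angular mass of the cone [A] is the integral of [W], that is, of [|x|^(-n)] over the part of
    [A] in the shell [-1 <= ln |x| < 0]. *)
Let W (x : n.-tuple R) : \bar R :=
  (\1_A x * \1_I (- lognorm x)%R * expR (- (n%:R * lognorm x)))%:E.

Let mlog := @measurable_lognorm n.
Let mindA : measurable_fun setT (\1_A : n.-tuple R -> R).
Proof. exact: measurable_indic. Qed.
Let mindI : measurable_fun setT (\1_I : R -> R).
Proof. exact: measurable_indic. Qed.

(* Insert the factor [1 = \int \1_I (t - lognorm x) dt], exchange the integrals,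
   and scale by [expR t]: this splits the radial variable from the direction
   without any uniqueness theorem for measures. *)
Lemma integral_polar : exists2 K : \bar R, 0 <= K &
  forall g : R -> \bar R, measurable_fun setT g -> (forall t, 0 <= g t) ->
  \int[L n]_x ((\1_A x)%:E * g (lognorm x)) =
  K * \int[mu]_t ((expR (n%:R * t))%:E * g t).
Proof.
exists (\int[L n]_x W x).
  by apply: integral_ge0 => x _; rewrite lee_fin !mulr_ge0// expR_ge0.
move=> g mg g0.
have mexp : measurable_fun setT (fun t : R => (expR (n%:R * t))%:E).
  apply/measurable_EFinP; apply: (measurableT_comp (@measurable_expR R)).
  exact: measurable_funM.
have mG : measurable_fun setT (fun t : R => (expR (n%:R * t))%:E * g t).
  exact: emeasurable_funM.
have intI : \int[mu]_t (\1_I t)%:E = 1.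
  rewrite integral_indic// setIT [LHS](@lebesgue_measure_itv R `]0%R, 1%R])/=.
  by rewrite lte_fin ltr01 oppr0 adde0.
pose f x t := (\1_A x)%:E * g (lognorm x) * (\1_I (t - lognorm x)%R)%:E.
have f0 x t : 0 <= f x t by rewrite /f !mule_ge0.
have mf : measurable_fun setT (fun p : n.-tuple R * mR => f p.1 p.2).
  apply: emeasurable_funM; last first.
    apply/measurable_EFinP; apply: (measurableT_comp mindI).
    apply: measurable_funB => //; exact: (measurableT_comp mlog).
  apply: emeasurable_funM.
    by apply/measurable_EFinP; exact: (measurableT_comp mindA).
  apply: (measurableT_comp mg); exact: (measurableT_comp mlog).
(* [h] is [f] after [x] is scaled by [expR t]: the cone is unchanged, [lognorm x] becomes
   [t + lognorm x], and [expR (n * t)] is the Jacobian. *)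
pose h x t := (\1_A x * \1_I (- lognorm x)%R)%:E * ((expR (n%:R * t))%:E * g (t + lognorm x)%R).
have h0 x t : 0 <= h x t by rewrite /h !mule_ge0// lee_fin ?expR_ge0// mulr_ge0.
have mh : measurable_fun setT (fun p : n.-tuple R * mR => h p.1 p.2).
  apply: emeasurable_funM.
    apply/measurable_EFinP; apply: measurable_funM.
      exact: (measurableT_comp mindA).
    apply: (measurableT_comp mindI); apply: measurable_funN.
    exact: (measurableT_comp mlog).
  apply: emeasurable_funM.
    exact: (measurableT_comp mexp).
  apply: (measurableT_comp mg); apply: measurable_funD => //.
  exact: (measurableT_comp mlog).
transitivity (\int[L n]_x \int[mu]_t f x t).
  apply: eq_integral => x _; rewrite /f ge0_integralZl//.
  - rewrite (integral_lebesgue_shift (f := fun t => (\1_I t)%:E))//.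
      by rewrite intI mule1.
    exact/measurable_EFinP.
  - apply/measurable_EFinP; apply: (measurableT_comp mindI).
    exact: measurable_funB.
  - by rewrite mule_ge0.
rewrite tonelli//.
transitivity (\int[mu]_t \int[L n]_x h x t).
  apply: eq_integral => t _.
  rewrite -(@integral_scale R n (f ^~ t) (expR t))//; last 2 first.
  - exact: expR_gt0.
  - exact: (measurable_comp2 mf).
  rewrite -ge0_integralZl//; last first.
    by apply: (measurable_comp2 mf) => //; exact: measurable_scale.
  apply: eq_integral => x _; rewrite /f /h.
  have -> : \1_A (scale (expR t) x) = \1_A x :> R.
    rewrite !indicE; congr ((_ : bool)%:R).
    by apply/idP/idP => /set_mem/A_scale Ax; apply/mem_set; apply: Ax; exact: expR_gt0.
  have [Ax|Ax] := pselect (A x); last by rewrite indicE memNset// !mul0r ?mul0e mule0.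
  rewrite lognorm_scale ?A_gt0// indicE mem_set// mul1e mul1r opprD addrA subrr add0r.
  by rewrite -expRM_natl muleA muleC.
rewrite -tonelli// -ge0_integralZr//; last 3 first.
- apply/measurable_EFinP; apply: measurable_funM.
    apply: measurable_funM => //; apply: (measurableT_comp mindI).
    exact: measurable_funN.
  apply: (measurableT_comp (@measurable_expR R)); apply: measurable_funN.
  exact: measurable_funM.
- by move=> x _; rewrite lee_fin !mulr_ge0// expR_ge0.
- by apply: integral_ge0 => t _; rewrite mule_ge0// lee_fin expR_ge0.
apply: eq_integral => x _.
(* Shifting [t] by [lognorm x] produces the argument of [g] found in [h]; the extra
   [expR (n * lognorm x)] is cancelled by the last factor of [W]. *)
rewrite -[in RHS](integral_lebesgue_shift (lognorm x) mG)//; last first.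
  by move=> t; rewrite mule_ge0// lee_fin expR_ge0.
rewrite -ge0_integralZl//; last 3 first.
- apply: (measurableT_comp mG); exact: measurable_funD.
- by move=> t _; rewrite mule_ge0// lee_fin expR_ge0.
- by rewrite lee_fin !mulr_ge0// expR_ge0.
apply: eq_integral => t _; rewrite /h /W !muleA -!EFinM; congr (_%:E * _).
by rewrite -!mulrA -expRD; congr (_ * (_ * expR _))%R; ring.
Qed.

End polar.

(** The inverse is rewritten through the measurable power function; at a zero of [f] both
    expressions are 0, as [0^-1 = 0]. *)
Lemma measurable_inv d (T : measurableType d) (R : realType) (f : T -> R) :
  measurable_fun setT f -> measurable_fun setT (fun x => (f x)^-1)%R.
Proof.
move=> mf.
rewrite (_ : (fun _ => _) = fun x => f x * ((f x ^+ 2) `^ (- 1)))%R.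
  apply: measurable_funM => //.
  apply: (measurableT_comp (measurable_powR (- 1)%R)); exact: measurable_funX.
apply/funext => x; rewrite powR_inv1 ?sqr_ge0//.
have [->|f0] := eqVneq (f x) 0%R; first by rewrite invr0 mul0r.
by rewrite expr2 invfM mulrA divff// mul1r.
Qed.

(** * The hyperbolic substitution *)

Section hyperbola.
Context {R : realType}.
Notation mu := (@lebesgue_measure R).
Notation mR := (measurableTypeR R).

(* [v = exp (2 t) - (q / 4) exp (- 2 t)] rationalizes [sqrt (v ^ 2 + q)]. *)
Lemma integral_hyperbola (G : R -> R -> \bar R) q : (0 < q)%R ->
  measurable_fun setT (fun z : mR * mR => G z.1 z.2) ->
  (forall a b, 0 <= G a b) ->
  \int[mu]_v (G v (Num.sqrt (v ^+ 2 + q))%R * ((Num.sqrt (v ^+ 2 + q))^-1)%:E) =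
  \int[mu]_t (2%:E * G (expR (2 * t) - q / 4 * expR (- (2 * t)))%R
    (expR (2 * t) + q / 4 * expR (- (2 * t)))%R).
Proof.
move=> q0 mG G0.
pose phi t : R := (expR (2 * t) - q / 4 * expR (- (2 * t)))%R.
pose sum t : R := (expR (2 * t) + q / 4 * expR (- (2 * t)))%R.
have sum_gt0 t : (0 < sum t)%R.
  by rewrite addr_gt0 ?mulr_gt0 ?expR_gt0.
have phi_sum t : Num.sqrt (phi t ^+ 2 + q) = sum t.
  rewrite -[RHS]gtr0_norm// -sqrtr_sqr; congr Num.sqrt.
  have e : (expR (2 * t) * expR (- (2 * t)) = 1)%R by rewrite -expRD subrr expR0.
  transitivity (phi t ^+ 2 + q * (expR (2 * t) * expR (- (2 * t))))%R.
    by rewrite e mulr1.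
  by rewrite /phi /sum; field.
(* Solving [phi t = v] as a quadratic equation in [exp (2 t)] and keeping the positive root gives
   [psi]. *)
pose psi v : R := (ln ((v + Num.sqrt (v ^+ 2 + q)) / 2) / 2)%R.
have mhyp : measurable_fun setT (fun v : R => Num.sqrt (v ^+ 2 + q)%R).
  apply: (measurableT_comp (continuous_measurable_fun (@sqrt_continuous R))).
  by apply: measurable_funD => //; exact: measurable_funX.
have h (c x : R) : is_derive x (1%R : R) (fun t : R => expR (c * t))%R (c * expR (c * x))%R.
  have hc : is_derive x (1%R : R) ( *%R c) c.
    by apply: is_derive_eq; rewrite /GRing.scale/= mulr1.
  apply: is_derive_eq (@is_derive1_comp R expR ( *%R c) x _ _
    (is_derive_expR (c * x)%R) hc) _.
  by rewrite mulrC.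
have hd x : is_derive x (1%R : R) phi (2 * sum x)%R.
  rewrite (_ : phi = fun t => expR (2 * t) - q / 4 * expR (- 2 * t))%R; last first.
    by apply/funext => t; rewrite mulNr.
  have h1 := h 2%R x; have h2 := h (- 2)%R x.
  apply: is_derive_eq.
  by rewrite /sum /GRing.scale/= !mulNr; field.
(* Here [dv = 2 (sum t) dt] and [sqrt (v^2 + q) = sum t], so the density cancels and leaves the
   factor 2. *)
rewrite (@change_of_variables R phi (fun t => 2 * sum t)%R psi hd).
- apply: eq_integral => t _; rewrite phi_sum -/(phi t) -/(sum t) -muleA -EFinM.
  by rewrite mulrCA mulVf ?gt_eqF// mulr1 muleC.
- move=> x; apply/differentiable_continuous/derivable1_diffP.
  rewrite (_ : (fun t => _) =
      fun t => 2 * (expR (2 * t) + q / 4 * expR (- 2 * t)))%R; last first.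
    by apply/funext => t; rewrite /sum mulNr.
  have h1 := h 2%R x; have h2 := h (- 2)%R x.
  exact: ex_derive.
- by move=> t; rewrite mulr_ge0// ltW.
- apply: le_mono => s t st; rewrite /phi.
  have st2 : (2 * s < 2 * t)%R by rewrite ltr_pM2l.
  apply: ltrB; first by rewrite ltr_expR.
  by rewrite ltr_pM2l ?divr_gt0// ltr_expR ltrN2.
- move=> v; rewrite /psi /phi mulrC divfK//.
  set r := Num.sqrt _.
  have r2 : (r ^+ 2 = v ^+ 2 + q)%R by rewrite sqr_sqrtr// addr_ge0 ?sqr_ge0// ltW.
  (* Since [q > 0] the root exceeds [|v|], so the logarithm in [psi] has a positive argument. *)
  have vr : (`|v| < r)%R.
    by rewrite -sqrtr_sqr ltr_sqrt ?ltrDl// (lt_le_trans q0)// lerDr sqr_ge0.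
  have E0 : (0 < (v + r) / 2)%R.
    by move: vr; rewrite ltr_norml => /andP[? ?]; lra.
  rewrite expRN lnK ?posrE//.
  have vr0 : (v + r != 0)%R by apply: contraTneq E0 => ->; rewrite mul0r ltxx.
  have -> : (q = r ^+ 2 - v ^+ 2)%R by rewrite r2; ring.
  by field.
- apply: emeasurable_funM.
    by apply: (measurable_comp2 mG).
  by apply/measurable_EFinP; exact: measurable_inv.
- by move=> v; rewrite mule_ge0// lee_fin invr_ge0 sqrtr_ge0.
Qed.

End hyperbola.

(** * From pairs of vectors to the density [1 / |w|] *)

Section gram_cone.
Context {R : realType}.
Notation mu := (@lebesgue_measure R).
Notation mR := (measurableTypeR R).
Notation L n := (@lebesgue_tuple R n).

(** The origin is negligible in positive dimension; later substitutions need a nonzero vector. *)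
Lemma integral_sq_gt0 n (f : n.+1.-tuple R -> \bar R) :
  measurable_fun setT f -> (forall x, 0 <= f x) ->
  \int[L n.+1]_x f x = \int[L n.+1]_(x in [set x | (0 < sq x)%R]) f x.
Proof.
move=> mf f0.
have mN : measurable [set x : n.+1.-tuple R | sq x = 0%R].
  rewrite -[X in measurable X]setTI; apply: (measurable_sq _ (Y := [set 0%R])) => //.
rewrite (ge0_negligible_integral mN)//; last exact: lebesgue_tuple_sq0.
congr (integral _ _ _); apply/seteqP; split => x /=.
  by move=> [_ /eqP x0]; rewrite lt_neqAle eq_sym x0 sq_ge0.
by move=> x0; split=> // /eqP; rewrite gt_eqF.
Qed.

Lemma measurable_sq_gt0 n : measurable [set x : n.-tuple R | (0 < sq x)%R].
Proof.
by apply: measurable_pred; apply: measurable_fun_ltr => //; exact: measurable_sq.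
Qed.

Lemma thead_scale n r (x : n.+1.-tuple R) : thead (scale r x) = (r * thead x)%R.
Proof. by rewrite /thead tnth_mktuple. Qed.

(** An identity of measures, tested against nonnegative [H]. The constant is chosen before [H],
    hence is common to all events. *)
Lemma integral_gram_cone k : exists2 K : \bar R, 0 <= K &
  forall H : R -> R -> R -> \bar R,
  measurable_fun setT (fun z : (mR * mR) * mR => H z.1.1 z.1.2 z.2) ->
  (forall a b c, 0 <= H a b c) ->
  \int[L k.+1]_x \int[L k.+1]_y H (sq x - sq y)%R (2 * dot x y)%R (sq x + sq y)%R =
  K * \int[L k.+2]_w (H (thead w) (thead [tuple of behead w]) (Num.sqrt (sq w)) *
                      ((Num.sqrt (sq w))^-1)%:E).
Proof.
set n := k.+1.
pose A : set (n.-tuple R) := [set x | (0 < sq x)%R].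
have mA : measurable A by exact: measurable_sq_gt0.
have A_scale r x : (0 < r)%R -> A (scale r x) <-> A x.
  by move=> r0; rewrite /A/= sq_scale pmulr_rgt0// exprn_gt0.
have [K K0 polarK] := integral_polar mA (fun x => id) A_scale.
(* [K] is the angular mass of the punctured space; [n] of the halves come from [u = 2 exp t y], the
   last one from [dt = dv / (2 sqrt (v^2 + |u|^2))]. *)
exists (K * (2^-1 ^+ n.+1)%:E); first by rewrite mule_ge0// lee_fin exprn_ge0.
move=> H mH H0.
have msq := @measurable_sq R n.
have mthead : measurable_fun setT (@thead k R) by exact: measurable_tnth.
pose h (t : R) (y : n.-tuple R) := H (expR (2 * t) - sq y)%R
  (2 * (expR t * thead y))%R (expR (2 * t) + sq y)%R.
pose g t := \int[L n]_y h t y.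
have mexp2 (c : R) : measurable_fun setT (fun t : R => expR (c * t)).
  by apply: (measurableT_comp (@measurable_expR R)); exact: measurable_funM.
have mgp : measurable_fun setT (fun p : mR * n.-tuple R => h p.1 p.2).
  have m1 : measurable_fun setT (fun p : mR * n.-tuple R => expR (2 * p.1)).
    exact: (measurableT_comp (mexp2 _)).
  have m2 : measurable_fun setT (fun p : mR * n.-tuple R => sq p.2).
    exact: (measurableT_comp msq).
  apply: (measurable_comp3 mH).
  - exact: measurable_funB.
  - apply: measurable_funM => //; apply: measurable_funM.
      exact: (measurableT_comp (@measurable_expR R)).
    exact: (measurableT_comp mthead).
  - exact: measurable_funD.
have h0 t y : 0 <= h t y by exact: H0.
have mg : measurable_fun setT g by exact: measurable_integral.
have g0 t : 0 <= g t by exact: integral_ge0.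
pose Q (t : R) (u : n.-tuple R) := 2%:E * H (expR (2 * t) - sq u / 4 * expR (- (2 * t)))%R (thead u)
                       (expR (2 * t) + sq u / 4 * expR (- (2 * t)))%R.
have Q0 t u : 0 <= Q t u by rewrite mule_ge0.
have mQ : measurable_fun setT (fun p : mR * n.-tuple R => Q p.1 p.2).
  have m1 : measurable_fun setT (fun p : mR * n.-tuple R => expR (2 * p.1)).
    exact: (measurableT_comp (mexp2 _)).
  have m2 : measurable_fun setT
      (fun p : mR * n.-tuple R => sq p.2 / 4 * expR (- (2 * p.1)))%R.
    apply: measurable_funM.
      by apply: measurable_funM => //; exact: (measurableT_comp msq).
    under eq_fun do rewrite -mulNr.
    exact: (measurableT_comp (mexp2 _)).
  apply: emeasurable_funM => //; apply: (measurable_comp3 mH).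
  - exact: measurable_funB.
  - exact: (measurableT_comp mthead).
  - exact: measurable_funD.
(* The Jacobian [(2 exp t)^n] of [u = 2 exp t y] absorbs exactly the weight [exp (n t)] of polar
   coordinates. *)
have gQ t : (expR (n%:R * t))%:E * g t = (2^-1 ^+ n.+1)%:E * \int[L n]_u Q t u.
  have r0 : (0 < 2 * expR t)%R by rewrite mulr_gt0 ?expR_gt0.
  rewrite -(@integral_scale R n (Q t) (2 * expR t)%R)//; last exact: (measurable_comp2 mQ).
  transitivity ((2^-1 ^+ n.+1)%:E * (((2 * expR t) ^+ n)%:E * (2%:E * g t))).
    rewrite !muleA -!EFinM; congr (_%:E * _).
    rewrite exprMn -expRM_natl exprSr.
    rewrite [RHS](_ : _ = ((2^-1 * 2) ^+ n * expR (n%:R * t) * (2^-1 * 2))%R).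
      by rewrite mulVf// expr1n mul1r mulr1.
    by rewrite exprMn; ring.
  rewrite /g -ge0_integralZl//; last exact: (measurable_comp2 mgp).
  congr (_ * (_ * _)); apply: eq_integral => y _; rewrite /Q thead_scale sq_scale.
  have e2 : expR (2 * t) = (expR t ^+ 2)%R by rewrite expRM_natl.
  have -> : ((2 * expR t) ^+ 2 * sq y / 4 * expR (- (2 * t)) = sq y)%R.
    by rewrite expRN e2; field; rewrite gt_eqF// expR_gt0.
  by rewrite /h mulrA.
(* For fixed nonzero [x], rotating [y] leaves a function of [|x| = exp (lognorm x)] alone, as the
   polar formula requires. *)
transitivity (\int[L n]_x ((\1_A x)%:E * g (lognorm x))).
  rewrite integral_sq_gt0; last 2 first.
  - apply: measurable_integral => //; apply: (measurable_comp3 mH).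
    + by apply: measurable_funB; exact: (measurableT_comp msq).
    + by apply: measurable_funM => //; exact: measurable_dot.
    + by apply: measurable_funD; exact: (measurableT_comp msq).
  - by move=> x; exact: integral_ge0.
  rewrite integral_mkcond; apply: eq_integral => x _; rewrite patchE indicE.
  case: ifPn => Ax; last by rewrite mul0e.
  move: Ax => /set_mem/= x0; rewrite mul1e.
  have := @integral_dot R k x (fun u v => H (sq x - v)%R (2 * u)%R (sq x + v)%R).
  move=> ->; last 2 first.
  - apply: (measurable_comp3 mH).
    + exact: measurable_funB.
    + exact: measurable_funM.
    + exact: measurable_funD.
  - by [].
  by rewrite /g /h expRM_natl expR_lognorm// sqr_sqrtr// ltW.
rewrite polarK// -muleA; congr (K * _).
under eq_integral do rewrite gQ.
rewrite ge0_integralZl//; last 2 first.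
- exact: measurable_integral.
- by move=> t _; exact: integral_ge0.
congr (_ * _); rewrite tonelli//.
pose P (v : R) (u : n.-tuple R) := H v (thead u) (Num.sqrt (v ^+ 2 + sq u)) *
  ((Num.sqrt (v ^+ 2 + sq u))^-1)%:E.
have P0 v u : 0 <= P v u by rewrite mule_ge0// lee_fin invr_ge0 sqrtr_ge0.
have mP : measurable_fun setT (fun p : mR * n.-tuple R => P p.1 p.2).
  have mr : measurable_fun setT
      (fun p : mR * n.-tuple R => Num.sqrt (p.1 ^+ 2 + sq p.2))%R.
    apply: (measurableT_comp (continuous_measurable_fun (@sqrt_continuous R))).
    apply: measurable_funD; last exact: (measurableT_comp msq).
    exact: measurable_funX.
  apply: emeasurable_funM; last by apply/measurable_EFinP; exact: measurable_inv.
  apply: (measurable_comp3 mH) => //; exact: (measurableT_comp mthead).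
transitivity (\int[L n]_u \int[mu]_v P v u).
  (* The point [u = 0] is removed on both sides because the hyperbolic substitution needs
     [q = |u|^2 > 0]. *)
  rewrite integral_sq_gt0; last 2 first.
  - apply: (@measurable_integral R _ _ _ _ mu (fun u t => Q t u)) => //.
    by apply: (measurable_comp2 mQ).
  - by move=> u; exact: integral_ge0.
  rewrite [RHS]integral_sq_gt0; last 2 first.
  - apply: (@measurable_integral R _ _ _ _ mu (fun u v => P v u)) => //.
    by apply: (measurable_comp2 mP).
  - by move=> u; exact: integral_ge0.
  apply: eq_integral => u /set_mem /= u0.
  rewrite -(@integral_hyperbola R (fun a b => H a (thead u) b) (sq u))//.
  by apply: (measurable_comp3 mH).
transitivity (\int[mu]_v \int[L n]_u P v u).
  exact/esym/(@tonelli R _ _ _ _ mu (L n) P mP P0).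
rewrite integral_lebesgue_tuple_cons; last 2 first.
- have mr : measurable_fun setT (fun w : n.+1.-tuple R => Num.sqrt (sq w)).
    apply: (measurableT_comp (continuous_measurable_fun (@sqrt_continuous R))).
    exact: measurable_sq.
  apply: emeasurable_funM; last by apply/measurable_EFinP; exact: measurable_inv.
  apply: (measurable_comp3 mH) => //; first exact: measurable_tnth.
  exact: (measurableT_comp mthead (@measurable_behead _ _ _)).
- by move=> w; rewrite mule_ge0// lee_fin invr_ge0 sqrtr_ge0.
apply: eq_integral => v _; apply: eq_integral => u _.
by rewrite sq_cons theadE; congr (H _ (thead _) _ * _); exact/val_inj.
Qed.

End gram_cone.

(** * Cones over the two events *)

Section cones.
Context {R : realType}.
Notation mu := (@lebesgue_measure R).
Notation mR := (measurableTypeR R).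
Notation L n := (@lebesgue_tuple R n).
Local Open Scope complex_scope.

Lemma behead_cons n a (w : n.-tuple R) : [tuple of behead [tuple of a :: w]] = w.
Proof. exact/val_inj. Qed.

Lemma nth_scale N c (z : N.-tuple R) k :
  nth 0%R (scale c z) k = (c * nth 0%R z k)%R.
Proof.
have [kN|Nk] := ltnP k N; last by rewrite !nth_default ?size_tuple ?mulr0.
by rewrite -!(tnth_nth 0%R _ (Ordinal kN)) tnth_mktuple.
Qed.

Lemma evens_scale n N c (z : N.-tuple R) : evens n (scale c z) = scale c (evens n z).
Proof. by apply: eq_from_tnth => i; rewrite !tnth_mktuple nth_scale. Qed.

Lemma odds_scale n N c (z : N.-tuple R) : odds n (scale c z) = scale c (odds n z).
Proof. by apply: eq_from_tnth => i; rewrite !tnth_mktuple nth_scale. Qed.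

Lemma dot_scale n c (x y : n.-tuple R) :
  dot (scale c x) (scale c y) = (c ^+ 2 * dot x y)%R.
Proof.
rewrite /dot mulr_sumr; apply: eq_bigr => i _.
by rewrite !tnth_mktuple expr2 mulrACA.
Qed.

Lemma sq_evens_odds n N (z : N.-tuple R) : N = n.*2 ->
  sq z = (sq (evens n z) + sq (odds n z))%R.
Proof.
elim: n N z => [|n IH] N z; rewrite ?double0 ?doubleS => NE.
  by subst N; rewrite /sq !big_ord0 addr0.
subst N; case/tupleP: z => a z; case/tupleP: z => b z.
by rewrite evens_cons odds_cons !sq_cons (IH _ z)//; ring.
Qed.

Variables (B : set (borelC R)) (mB : measurable B).

(** The event read on a triple [((a, b), r)] of real part, imaginary part and radius. The radius is
    [|z|^2] on [R^(2n)], where the variable has degree two, and [|w|] on [R^(n+1)], where it has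
    degree one. *)
Definition direction_in : set ((mR * mR) * mR) :=
  [set z | (0 < z.2 <= 1)%R] `&`
  ((fun z => (z.1.1 / z.2)%R +i* (z.1.2 / z.2)%R : borelC R) @^-1` B).

Definition direction_indic (a b r : R) : \bar R := (\1_direction_in ((a, b), r))%:E.

Lemma measurable_direction_in : measurable direction_in.
Proof.
have m2 : measurable_fun setT (fun z : (mR * mR) * mR => (z.2)^-1)%R.
  exact: measurable_inv.
apply: measurableI.
  by apply: measurable_pred; apply: measurable_and; [exact: measurable_fun_ltr|
    exact: measurable_fun_ler].
rewrite -[X in measurable X]setTI.
apply: (measurable_complex _ _ measurableT mB).
  apply: measurable_funM => //; exact: (measurableT_comp measurable_fst).
apply: measurable_funM => //; exact: (measurableT_comp measurable_snd).
Qed.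

Lemma measurable_direction_indic :
  measurable_fun setT (fun z : (mR * mR) * mR => direction_indic z.1.1 z.1.2 z.2).
Proof.
apply/measurable_EFinP.
rewrite (_ : (fun _ => _) = \1_direction_in); last by apply/funext => -[[]].
apply: measurable_indic; exact: measurable_direction_in.
Qed.

Lemma direction_indic_ge0 a b r : 0 <= direction_indic a b r.
Proof. by rewrite lee_fin. Qed.

Lemma cone_measure_integral d (A : set (sphere R d)) : measurable A ->
  cone_measure A = \int[L d.+1]_x (\1_(cone A) x)%:E.
Proof.
by move=> mA; rewrite integral_indic ?setIT//; exact: measurable_cone.
Qed.

(** By homogeneity of degree two, the value at the direction of [z] is the value at [z] divided by
    [|z|^2], so the cone over the event is cut out by [direction_in]. *)
Lemma cone_measure_sum_sqr_zcoord k :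
  cone_measure (@sum_sqr_zcoord R k.+1 @^-1` B) =
  \int[L k.+1]_x \int[L k.+1]_y
    direction_indic (sq x - sq y)%R (2 * dot x y)%R (sq x + sq y)%R.
Proof.
set n := k.+1; set N := (2 * n).-1.+1.
have NE : N = n.*2 by rewrite /N prednK ?mul2n.
rewrite -(@integral_evens_odds R n N (fun x y =>
  direction_indic (sq x - sq y)%R (2 * dot x y)%R (sq x + sq y)%R))//; last 2 first.
- apply: (measurable_comp3 (f := direction_indic) measurable_direction_indic).
  + by apply: measurable_funB; exact: (measurableT_comp (@measurable_sq R n)).
  + by apply: measurable_funM => //; exact: measurable_dot.
  + by apply: measurable_funD; exact: (measurableT_comp (@measurable_sq R n)).
- by move=> x y; exact: direction_indic_ge0.
rewrite cone_measure_integral; last first.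
  by rewrite -[X in measurable X]setTI; exact: measurable_sum_sqr_zcoord.
apply: eq_integral => z _; rewrite /direction_indic !indicE; congr ((_ : bool)%:R%:E).
pose W (z : N.-tuple R) : borelC R :=
  (sq (evens n z) - sq (odds n z))%R +i* (2 * dot (evens n z) (odds n z))%R.
have XW : @sum_sqr_zcoord R n @^-1` B = @sphere_val R (2 * n).-1 @^-1` (W @^-1` B).
  suff XE u : sum_sqr_zcoord u = W (sphere_val u).
    by apply/seteqP; split => u /=; rewrite XE.
  rewrite sum_sqr_zcoordE /W /sq /dot -sumrB mulr_sumr.
  (* The indices [2 j] and [2 j + 1] are below [2 n], so [inord] does not fall back on its
     default. *)
  have nthE (j : 'I_n) : tnth (evens n (sphere_val u)) j = tnth (sphere_val u) (inord (2 * j)).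
    by rewrite tnth_mktuple (tnth_nth 0%R) inordK// -/N NE -mul2n ltn_pmul2l.
  have nthO (j : 'I_n) : tnth (odds n (sphere_val u)) j = tnth (sphere_val u) (inord (2 * j).+1).
    rewrite tnth_mktuple (tnth_nth 0%R) inordK// -/N NE -mul2n.
    by apply: (@leq_trans (2 * j.+1)%N); rewrite ?leq_pmul2l// mulnS.
  by congr (_ +i* _); apply: eq_bigr => j _; rewrite nthE nthO.
have sqE : sqnorm z = (sq (evens n z) + sq (odds n z))%R by exact: sq_evens_odds.
have dirE : (0 < sqnorm z)%R -> W (dir z) =
    ((sq (evens n z) - sq (odds n z)) / sqnorm z)%R +i*
    (2 * dot (evens n z) (odds n z) / sqnorm z)%R.
  move=> z0; rewrite /W (_ : dir z = scale (sqnorm z `^ (- 2^-1))%R z)//.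
  have c2 : ((sqnorm z `^ (- 2^-1)) ^+ 2 = (sqnorm z)^-1)%R.
    by rewrite powRN powR12_sqrt ?ltW// exprVn sqr_sqrtr ?ltW.
  by rewrite evens_scale odds_scale !sq_scale dot_scale c2; congr (_ +i* _); ring.
rewrite XW cone_preimage.
apply/idP/idP => /set_mem [/= z01 Bz]; apply/mem_set.
  split; rewrite /= -sqE//; have [z0 _] := andP z01.
  by rewrite -dirE.
rewrite -sqE in z01; split => //=; have [z0 _] := andP z01.
by rewrite dirE// sqE.
Qed.

(** The unbounded cone, without the condition [|w| <= 1]: polar integration requires invariance
    under all dilations. *)
Definition direction_cone n : set (n.+2.-tuple R) :=
  [set w | (0 < sq w)%R] `&`
  ((fun w => (thead w / Num.sqrt (sq w))%R +i*
    (thead [tuple of behead w] / Num.sqrt (sq w))%R : borelC R) @^-1` B).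

Lemma measurable_sqrt_sq n : measurable_fun setT (fun w : n.-tuple R => Num.sqrt (sq w)).
Proof.
apply: (measurableT_comp (continuous_measurable_fun (@sqrt_continuous R))).
exact: measurable_sq.
Qed.

Lemma measurable_direction_cone n : measurable (@direction_cone n).
Proof.
apply: measurableI; first exact: measurable_sq_gt0.
rewrite -[X in measurable X]setTI.
apply: (measurable_complex _ _ measurableT mB); apply: measurable_funM.
- exact: measurable_tnth.
- by apply: measurable_inv; exact: measurable_sqrt_sq.
- apply: (measurableT_comp (measurable_tnth ord0)); exact: measurable_behead.
- by apply: measurable_inv; exact: measurable_sqrt_sq.
Qed.

Lemma direction_cone_scale n r (w : n.+2.-tuple R) : (0 < r)%R ->
  direction_cone (scale r w) <-> direction_cone w.
Proof.
move=> r0; rewrite /direction_cone/= sq_scale pmulr_rgt0 ?exprn_gt0//.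
rewrite sqrtrM ?sqr_ge0// sqrtr_sqr gtr0_norm// thead_scale.
have -> : thead [tuple of behead (scale r w)] = (r * thead [tuple of behead w])%R.
  by case/tupleP: w => a w; rewrite scale_cons !behead_cons thead_scale.
by rewrite -!mulf_div divff ?gt_eqF// !mul1r.
Qed.

(** The truncation to the unit ball reads [lognorm w <= 0] and becomes a radial factor, ready for
    the polar formula. *)
Lemma cone_measure_first_two_coord n :
  cone_measure (@first_two_coord R n.+1 @^-1` B) =
  \int[L n.+2]_w ((\1_(@direction_cone n) w)%:E *
                  (\1_[set t : R | (t <= 0)%R] (lognorm w))%:E).
Proof.
rewrite cone_measure_integral; last first.
  by rewrite -[X in measurable X]setTI; exact: measurable_first_two_coord.
apply: eq_integral => w _; rewrite -EFinM; congr EFin.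
pose W (w : n.+2.-tuple R) : borelC R := thead w +i* thead [tuple of behead w].
have XW : @first_two_coord R n.+1 @^-1` B = @sphere_val R n.+1 @^-1` (W @^-1` B).
  suff XE u : first_two_coord u = W (sphere_val u).
    by apply/seteqP; split => u /=; rewrite XE.
  rewrite /first_two_coord /W; case/tupleP: (sphere_val u) => a w'.
  congr (_ +i* _).
    by congr tnth; apply/val_inj; rewrite /= inordK.
  rewrite (_ : inord 1 = lift ord0 ord0 :> 'I_n.+2); last first.
    by apply/val_inj; rewrite /= inordK.
  by rewrite tnthS behead_cons.
have dirE : (0 < sq w)%R -> W (dir w) =
    (thead w / Num.sqrt (sq w))%R +i* (thead [tuple of behead w] / Num.sqrt (sq w))%R.
  move=> w0; rewrite /W (_ : dir w = scale (Num.sqrt (sq w))^-1%R w); last first.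
    by rewrite -powR12_sqrt ?ltW// -powRN.
  rewrite thead_scale mulrC; congr (_ +i* _).
  by case/tupleP: w {w0} => a w'; rewrite scale_cons !behead_cons thead_scale mulrC.
rewrite XW cone_preimage !indicE -natrM mulnb; congr ((_ : bool)%:R).
have logE : (0 < sq w)%R -> (lognorm w <= 0)%R = (sq w <= 1)%R.
  move=> w0; rewrite -ler_expR expR0 expR_lognorm//.
  by rewrite -[in LHS](sqrtr1 R) ler_sqrt.
apply/idP/idP => [/set_mem[/= /andP[w0 w1] Bw]|/andP[/set_mem[/= w0 Bw] /set_mem/=]].
  apply/andP; split; apply/mem_set => /=; last by rewrite logE.
  by split => //=; rewrite -dirE.
by rewrite logE// => w1; apply/mem_set; split => /=; [rewrite w0|rewrite dirE].
Qed.

(** Off the origin [1 / |w|] is [expR (- lognorm w)]; at the origin the indicators of the event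
    vanish on both sides. *)
Lemma direction_indic_cone n (w : n.+2.-tuple R) :
  direction_indic (thead w) (thead [tuple of behead w]) (Num.sqrt (sq w)) *
    ((Num.sqrt (sq w))^-1)%:E =
  (\1_(@direction_cone n) w)%:E *
    (\1_[set t : R | (t <= 0)%R] (lognorm w) * expR (- lognorm w))%:E.
Proof.
have [w0|w0] := ltP 0%R (sq w); last first.
  have {}w0 : sq w = 0%R by apply/eqP; rewrite eq_le w0 sq_ge0.
  rewrite /direction_indic !indicE memNset; last by case=> /=; rewrite w0 sqrtr0 ltxx.
  by rewrite memNset ?mul0e//; case => /=; rewrite w0 ltxx.
have logE : (lognorm w <= 0)%R = (Num.sqrt (sq w) <= 1)%R.
  by rewrite -ler_expR expR0 expR_lognorm.
rewrite expRN expR_lognorm// /direction_indic -!EFinM mulrA; congr (_ * _)%:E.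
rewrite !indicE -natrM mulnb; congr ((_ : bool)%:R).
apply/idP/idP => [/set_mem[/= /andP[_ w1] Bw]|/andP[/set_mem[/= _ Bw] /set_mem/=]].
  by apply/andP; split; apply/mem_set => //=; rewrite logE.
by rewrite logE => w1; apply/mem_set; split => //=; rewrite sqrtr_gt0 w0.
Qed.

End cones.

(** * Quotients of finite masses in the extended reals *)

Section ratio.
Context {R : realFieldType}.
Implicit Types x y : \bar R.

Lemma pmule_fin_factors x y : 0 <= x -> 0 <= y -> 0 < x * y -> x * y < +oo ->
  exists r s : R, [/\ (0 < r)%R, (0 < s)%R, x = r%:E & y = s%:E].
Proof.
move=> x0 y0 xy0 xyoo.
have {}x0 : 0 < x.
  by rewrite lt0e x0 andbT; apply: contraTneq xy0 => ->; rewrite mul0e ltxx.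
have {}y0 : 0 < y.
  by rewrite lt0e y0 andbT; apply: contraTneq xy0 => ->; rewrite mule0 ltxx.
case: x x0 xyoo {xy0} => [r| |]//; last by rewrite gt0_mulye.
case: y y0 => [s| |]//; last by move=> _ r0; rewrite gt0_muley.
by rewrite !lte_fin => s0 r0 _; exists r, s.
Qed.

(** Both sides equal [KB / KT]: the constant [K] and the radial integrals [C1], [C2] cancel. The
    bounds force all five quantities to be real, with everything except [KB] known to be
    positive. *)
Lemma ratio_mule (K KT KB C1 C2 : \bar R) :
  0 <= K -> 0 <= KT -> 0 <= KB -> 0 <= C1 -> 0 <= C2 ->
  0 < K * (KT * C1) -> K * (KT * C1) < +oo ->
  0 < KT * C2 -> KT * C2 < +oo -> KB * C2 < +oo ->
  ((fine (K * (KT * C1)))^-1)%:E * (K * (KB * C1)) =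
  ((fine (KT * C2))^-1)%:E * (KB * C2).
Proof.
move=> K0 KT0 KB0 C10 C20 a0 aoo b0 boo cB.
have [k [t1 [k0 _ -> t1E]]] := pmule_fin_factors K0 (mule_ge0 KT0 C10) a0 aoo.
have [t [c2 [t0 c20 KTE C2E]]] := pmule_fin_factors KT0 C20 b0 boo.
have [t' [c1 [t'0 c10 KTE' C1E]]] : exists r s : R,
    [/\ (0 < r)%R, (0 < s)%R, KT = r%:E & C1 = s%:E].
  apply: pmule_fin_factors => //.
    rewrite lt0e mule_ge0// andbT.
    by apply: contraTneq a0 => ->; rewrite mule0 ltxx.
  by rewrite t1E ltry.
have [b bE] : exists b : R, KB = b%:E.
  case: KB KB0 cB => [b| |]//; first by exists b.
  by rewrite C2E gt0_mulye.
rewrite C1E C2E bE KTE -!EFinM/=; congr EFin.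
by field; rewrite ?gt_eqF.
Qed.

End ratio.

(* Comparison of the two laws *)
Local Close Scope ereal_scope.

Theorem theorem8p2 (R : realType) (n : nat) (hn : (1 <= n)%N)
    (B : set (borelC R)) (mB : measurable B) :
  distribution (@uniform_sphere R (2 * n).-1) (@sum_sqr_zcoord R n) B =
  distribution (@uniform_sphere R n) (@first_two_coord R n) B.
Proof.
case: n hn => // k _.
have [K K0 gramK] := @integral_gram_cone R k.
(* Radial profiles of the two cones: both stop at [|w| = 1], and [g1] also carries the density
   [1 / |w|]. *)
pose g1 (t : R) : \bar R := (\1_[set t : R | t <= 0] t * expR (- t))%:E.
pose g2 (t : R) : \bar R := (\1_[set t : R | t <= 0] t)%:E.
have g10 t : (0 <= g1 t)%E by rewrite lee_fin mulr_ge0// expR_ge0.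
have g20 t : (0 <= g2 t)%E by rewrite lee_fin.
have mneg : measurable_fun setT (\1_[set t : R | t <= 0] : R -> R).
  apply: measurable_indic; apply: measurable_pred.
  exact: measurable_fun_ler.
have mg1 : measurable_fun setT g1.
  apply/measurable_EFinP; apply: measurable_funM => //.
  apply: (measurableT_comp (@measurable_expR R)); exact: measurable_funN.
have mg2 : measurable_fun setT g2 by exact/measurable_EFinP.
pose C g := (\int[lebesgue_measure]_(t in [set: R]) ((expR (k.+2%:R * t))%:E * g t))%E.
have C0 g : (forall t, 0 <= g t)%E -> (0 <= C g)%E.
  by move=> g0; apply: integral_ge0 => t _; rewrite mule_ge0// lee_fin expR_ge0.
(* One angular mass [KD], that of [direction_cone D], governs both cones, while [K], [C g1] and
   [C g2] do not depend on [D]. *)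
have cones D : measurable D -> exists2 KD : \bar R, (0 <= KD)%E &
    cone_measure (@sum_sqr_zcoord R k.+1 @^-1` D) = (K * (KD * C g1))%E /\
    cone_measure (@first_two_coord R k.+1 @^-1` D) = (KD * C g2)%E.
  move=> mD.
  have [KD KD0 polarD] := @integral_polar R k.+2 (direction_cone D (n := k))
    (@measurable_direction_cone R D mD k) (fun w => @proj1 _ _)
    (fun r w => @direction_cone_scale R D k r w).
  exists KD => //; split.
    rewrite cone_measure_sum_sqr_zcoord// gramK; last 2 first.
    - exact: measurable_direction_indic.
    - exact: direction_indic_ge0.
    rewrite -polarD//; congr (_ * _)%E; apply: eq_integral => w _.
    exact: direction_indic_cone.
  by rewrite cone_measure_first_two_coord//; exact: (polarD g2).
(* The whole space supplies the normalizing constants and [B] the numerators. *)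
have [KT KT0 [aT bT]] := cones setT measurableT.
have [KB KB0 [aB bB]] := cones B mB.
rewrite !preimage_setT in aT bT.
rewrite /distribution /pushforward /= /uniform_sphere aB bB aT bT.
apply: ratio_mule => //; rewrite -?aT -?bT -?bB.
- exact: C0.
- exact: C0.
- exact: cone_measure_setT_gt0.
- exact: cone_measure_setT_lty.
- exact: cone_measure_setT_gt0.
- exact: cone_measure_setT_lty.
apply: le_lt_trans (cone_measure_setT_lty R k.+1).
apply: le_measure; rewrite ?inE//.
by rewrite -[X in measurable X]setTI; exact: measurable_first_two_coord.
Qed.
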